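(* Let $m,\alpha,\beta\ge 1$ be integers with $2\nmid\alpha$, let $c(n)$ be defined by $$\sum_{n=0}^{\infty}c(n)q^n:=f_1^3f_2^6,$$ and let $p\ge 3$ be a prime. Define $$\kappa(p):=c\left(\frac{5(p^2-1)}{8}\right)+p^3\left(\frac{-\frac54(p^2-1)}{p}\right)_L,$$ and $$\nu(p):=\begin{cases}4,&\text{if }\kappa(p)\equiv 0\pmod 2,\\ 6,&\text{if }\kappa(p)\equiv 1\pmod 2.\end{cases}$$ (1) For all integers $n,k\ge 0$ with $p\nmid n$, $$\bar a_{2^m\alpha}\left(8p^{\nu(p)(k+1)-1}n+5p^{\nu(p)(k+1)}\right)\equiv 0\pmod{2^{m+3}},$$ $$\bar a_{2\beta+1}\left(8p^{\nu(p)(k+1)-1}n+5p^{\nu(p)(k+1)}\right)\equiv 0\pmod{16}.$$ (2) If $\kappa(p)\equiv 1\pmod 2$, then for all integers $n,k\ge 0$ with $p\nmid(8n+5)$, $$\bar a_{2^m\alpha}\left(8p^{6k+2}n+5p^{6k+2}\right)\equiv 0\pmod{2^{m+3}},$$ $$\bar a_{2\beta+1}\left(8p^{6k+2}n+5p^{6k+2}\right)\equiv 0\pmod{16}.$$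
   Context: For integers $\ell\ge1$ write $f_\ell=\prod_{j\ge 1}(1-q^{\ell j})$. For a positive integer $s$, $\bar a_s(n)$ denotes the number of partitions of $n$ in which each odd part occurs in one of $s$ colors and the first occurrence of each part (parts of the same size but different colors being distinct) may be overlined. Equivalently, $$\sum_{n\ge0}\bar a_s(n)q^n=\frac{f_2^{3s-2}}{f_1^{2s}f_4^{s-1}}.$$ $\left(\frac{\cdot}{p}\right)_L$ is the Legendre symbol modulo the odd prime $p$ (equal to $0$ on multiples of $p$). *)

(* Defs.v *)
From mathcomp Require Import all_boot all_order all_algebra.

Set Implicit Arguments.
Unset Strict Implicit.
Unset Printing Implicit Defensive.

Import Order.TTheory GRing.Theory Num.Theory.
Local Open Scope ring_scope.

(* A part of size at most n carrying one of s colours: (j, k) stands for the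
   size j.+1 and the colour k. Colour 0 is the only one allowed on an even
   size. *)
Notation cpart s n := ('I_n * 'I_s)%type.

Definition psize (s n : nat) (x : cpart s n) : nat := x.1.+1.

Definition allowed (s n : nat) (x : cpart s n) : bool :=
  odd (psize x) || (x.2 == 0%N :> nat).

(* A pair (M, O): M x is the multiplicity of the coloured part x, and O is the
   set of coloured parts whose first occurrence is overlined. The sizes and the
   multiplicities in a partition of n are at most n. *)
Definition colored_overpartitions (s n : nat) :
    {set {ffun cpart s n -> 'I_n.+1} * {set cpart s n}} :=
  [set P : {ffun cpart s n -> 'I_n.+1} * {set cpart s n} |
    [&& [forall x, (0 < P.1 x)%N ==> allowed x],
        [forall x in P.2, (0 < P.1 x)%N]
      & \sum_x P.1 x * psize x == n]%N].

Definition abar (s n : nat) : nat := #|colored_overpartitions s n|.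

(* Formal power series over int, as coefficient sequences. *)
Definition ps1 : nat -> int := fun n => (n == 0%N)%:R.

Definition psmul (a b : nat -> int) : nat -> int :=
  fun n => \sum_(i < n.+1) a i * b (n - i)%N.

Definition psexp (a : nat -> int) (e : nat) : nat -> int :=
  iter e (psmul a) ps1.

Definition euler_partial (l N : nat) : {poly int} :=
  \prod_(1 <= j < N.+1) (1 - 'X^(l * j)).

(* The infinite product \prod_(j >= 1) (1 - q ^ (l * j)), for 0 < l; its n-th
   coefficient is the eventual one of the partial products, see
   coef_euler_partial. *)
Definition euler (l : nat) : nat -> int := fun n => (euler_partial l n)`_n.

Lemma coef_euler_partial (l n N : nat) :
  (0 < l)%N -> (n <= N)%N -> (euler_partial l N)`_n = euler l n.
Proof.
move=> l_gt0 /subnKC <-; elim: (N - n)%N => [|k IHk]; first by rewrite addn0.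
rewrite -IHk addnS /euler_partial big_nat_recr //= mulrBr mulr1 coefB coefMXn.
have -> : (n < l * (n + k).+1)%N.
  by rewrite (leq_trans _ (leq_pmull _ l_gt0)) // ltnS leq_addr.
by rewrite subr0.
Qed.

(* f_1 ^ 3 * f_2 ^ 6 *)
Definition c : nat -> int := psmul (psexp (euler 1) 3) (psexp (euler 2) 6).

Definition legendre (a : int) (p : nat) : int :=
  if (p %| a)%Z then 0
  else if [exists x : 'I_p, (x%:Z ^+ 2 == a %[mod p])%Z] then 1 else -1.

(* For p odd, 8 divides p ^ 2 - 1, so both divisions are exact. *)
Definition kappa (p : nat) : int :=
  c ((5 * (p ^ 2 - 1)) %/ 8)%N
  + p%:Z ^+ 3 * legendre (- ((5 * (p ^ 2 - 1)) %/ 4)%N%:Z) p.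

Definition nu (p : nat) : nat := if (2 %| kappa p)%Z then 4%N else 6%N.

(* Main.v *)
Require Import Defs.
From mathcomp Require Import all_boot all_order all_algebra.
From mathcomp Require Import finmap zify ring.

(* Put t = sum_(i >= 1) (-1)^i q^(i^2).  By Gauss, f_1^2 / f_2 = 1 + 2 t(q), so
   the generating function of abar_s is (1 + 2 t(q^2))^(s-1) / (1 + 2 t(q))^s.
   Expanding modulo 2^(m+3), resp. 16, and using t(q)^2 = t(q^2) mod 2, the
   coefficient of q^N for N = 5 mod 8 is a multiple of 2^(m+2), resp. 8, and
   vanishes as soon as the number C(N) of solutions of
   (2i+1)^2 + (2j+2)^2 = N is even.

   Since f_1^3 = sum q^(k(k+1)/2) mod 2, c(n) = C(8n+5) mod 2.  On the other hand
   8 C(N) is the number of Gaussian integers of norm N, and for a prime p that is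
   a norm, multiplication by the two primes above p gives
   #(pN) + #(N/p) = 2 #(N); otherwise #(pN) = #(N/p).  Hence C(5 p^2) is odd for
   p <> 5 while C(125) is even, so that kappa(p) is always even: nu(p) = 4 and
   part (2) is vacuous.  In part (1), p divides N exactly 4k+3 times, and the same
   recursion shows that C(N) is even. *)

Set Implicit Arguments.
Unset Strict Implicit.
Unset Printing Implicit Defensive.

Import Order.TTheory GRing.Theory Num.Theory.
Local Open Scope fset_scope.
Local Open Scope ring_scope.

(** * Congruences of truncated power series *)

(* Congruence of power series modulo d and q^k; d = 0 gives equality up to q^k. *)
Definition eqmX (d : int) (k : nat) (P Q : {poly int}) : Prop :=
  forall i, (i < k)%N -> (d %| P`_i - Q`_i)%Z.

Lemma eqmX_refl d k P : eqmX d k P P.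
Proof. by move=> i _; rewrite subrr dvdz0. Qed.

Lemma eqmX_sym d k P Q : eqmX d k P Q -> eqmX d k Q P.
Proof. by move=> h i /h; rewrite -opprB rpredN. Qed.

Lemma eqmX_trans d k P Q R : eqmX d k P Q -> eqmX d k Q R -> eqmX d k P R.
Proof. by move=> h1 h2 i ik; rewrite -(subrKA Q`_i) rpredD ?h1 ?h2. Qed.

Lemma eqmX_weak d d' k k' P Q :
  (d' %| d)%Z -> (k' <= k)%N -> eqmX d k P Q -> eqmX d' k' P Q.
Proof.
by move=> dd kk h i ik; apply: dvdz_trans dd _; apply/h/(leq_trans ik).
Qed.

Lemma eqmX0 d k P Q : eqmX 0 k P Q -> eqmX d k P Q.
Proof. exact: eqmX_weak. Qed.

Lemma eqmXD d k P P' Q Q' :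
  eqmX d k P P' -> eqmX d k Q Q' -> eqmX d k (P + Q) (P' + Q').
Proof.
by move=> h1 h2 i ik; rewrite !coefD opprD addrACA rpredD ?h1 ?h2.
Qed.

Lemma eqmX_mull d k P Q Q' : eqmX d k Q Q' -> eqmX d k (P * Q) (P * Q').
Proof.
move=> h i ik; rewrite -coefB -mulrBr coefM.
apply: rpred_sum => j _; apply: dvdz_mull.
by rewrite coefB h // (leq_ltn_trans (leq_subr _ _)).
Qed.

Lemma eqmX_mulr d k P Q Q' : eqmX d k Q Q' -> eqmX d k (Q * P) (Q' * P).
Proof. by move=> h; rewrite ![_ * P]mulrC; apply: eqmX_mull. Qed.

Lemma eqmXM d k P P' Q Q' :
  eqmX d k P P' -> eqmX d k Q Q' -> eqmX d k (P * Q) (P' * Q').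
Proof.
by move=> h1 h2; apply: eqmX_trans (eqmX_mull _ h2) (eqmX_mulr _ h1).
Qed.

Lemma eqmXX d k P P' e : eqmX d k P P' -> eqmX d k (P ^+ e) (P' ^+ e).
Proof.
by move=> h; elim: e => [|e IH]; rewrite ?exprS; [exact: eqmX_refl | exact: eqmXM].
Qed.

Lemma eqmX_prod d k (I : finType) (A : pred I) (F G : I -> {poly int}) :
  (forall i, A i -> eqmX d k (F i) (G i)) ->
  eqmX d k (\prod_(i | A i) F i) (\prod_(i | A i) G i).
Proof.
move=> h; apply: (big_rec2 (fun x y => eqmX d k x y)) => [|i x y Ai hxy].
  exact: eqmX_refl.
by apply: eqmXM => //; apply: h.
Qed.

(** A series with constant term 1 is a unit. In strong induction on the index, the current
    coefficient of [P - Q] is the only term of the convolution not yet known to be divisible by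
    [d]. *)
Lemma eqmX_cancel d k (P Q D : {poly int}) :
  D`_0 = 1 -> eqmX d k (P * D) (Q * D) -> eqmX d k P Q.
Proof.
move=> D0 h i; elim/ltn_ind: i => i IH ik; have := h i ik.
rewrite -coefB -mulrBl coefM big_ord_recr /= subnn D0 mulr1 coefB.
rewrite rpredDl //; apply: rpred_sum => j _.
by rewrite dvdz_mulr // coefB IH // (ltn_trans _ ik).
Qed.

Lemma eqmX_multX d k P Q : eqmX d k (P + d%:P * Q) P.
Proof. by move=> i _; rewrite coefD coefCM addrC addKr dvdz_mulr. Qed.

Lemma eqmX_addXn d k n P Q : (k <= n)%N -> eqmX d k (P + 'X^n * Q) P.
Proof.
by move=> kn i ik; rewrite coefD addrC addKr coefXnM (leq_trans ik kn) dvdz0.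
Qed.

Lemma eqmX_comp d k P Q :
  eqmX d k P Q -> eqmX d k.*2 (P \Po 'X^2) (Q \Po 'X^2).
Proof.
move=> h i ik; rewrite !coef_comp_poly_Xn //; case: ifP => _.
  by apply: h; rewrite divn2; lia.
by rewrite subrr dvdz0.
Qed.

(** Horner induction: the cross term is even, and a^2 = a modulo 2 for an integer coefficient a. *)
Lemma eqmX_frobenius k P : eqmX 2 k (P ^+ 2) (P \Po 'X^2).
Proof.
elim/poly_ind: P => [|P a IH].
  by rewrite comp_poly0 expr0n; apply: eqmX_refl.
rewrite comp_polyD comp_polyM comp_polyX comp_polyC.
have [b hb] : exists b : int, a ^+ 2 = a + b * 2.
  suff /dvdzP[b hb] : (2 %| a ^+ 2 - a)%Z by exists b; rewrite -hb addrC subrK.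
  have -> : a ^+ 2 - a = a * (a - 1) by ring.
  by rewrite dvdzE dvdn2 abszM oddM; lia.
have -> : (P * 'X + a%:P) ^+ 2 =
   P ^+ 2 * 'X^2 + a%:P + 2%:P * (P * 'X * a%:P + b%:P).
  have ha : a%:P ^+ 2 = a%:P + b%:P * 2%:P :> {poly int}.
    by rewrite -rmorphXn hb rmorphD rmorphM.
  by rewrite sqrrD ha; ring.
apply: eqmX_trans; first exact: eqmX_multX.
by apply: eqmXD; [apply: eqmX_mulr | apply: eqmX_refl].
Qed.

(** * Two identities of Gauss *)

(** With q = [x], this product and the next three are (-q;q)_k, (q;q)_k / (q;q)_s, (q;q^2)_k and
    (q^2;q^2)_k / (q^2;q^2)_s. The lower bound [s] encodes the cleared denominator. *)
Definition plus_prod (R : comNzRingType) (x : R) (k : nat) : R :=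
  \prod_(0 <= j < k) (1 + x ^+ j.+1).

Definition minus_prod (R : comNzRingType) (x : R) (k s : nat) : R :=
  \prod_(s <= j < k) (1 - x ^+ j.+1).

Definition odd_prod (R : comNzRingType) (x : R) (k : nat) : R :=
  \prod_(0 <= j < k) (1 - x ^+ j.*2.+1).

Definition even_prod (R : comNzRingType) (x : R) (k s : nat) : R :=
  \prod_(s <= j < k) (1 - x ^+ j.*2.+2).

(* Shanks's telescoping proof: the sum over s below interpolates between the
   product (s = 0) and the theta series, with all denominators cleared. *)
Lemma shanks_square_step (R : comNzRingType) (x : R) (n r : nat)
    (F := fun k t => minus_prod x k 0%N + 2 * \sum_(0 <= s < t)
       (-1) ^+ s.+1 * x ^+ (s.+1 * k.+1) * plus_prod x s * minus_prod x k s.+1) :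
  (r <= n)%N ->
  F n.+1 r = (1 + x ^+ n.+1) * F n r
             + 2 * (-1) ^+ r.+1 * x ^+ (r.+1 * n.+1) * plus_prod x r * minus_prod x n r.
Proof.
have KS s : (s <= n)%N -> minus_prod x n.+1 s = minus_prod x n s * (1 - x ^+ n.+1).
  by move=> sn; rewrite /minus_prod big_nat_recr.
rewrite /F; elim: r => [_|r IH rn].
  rewrite !big_geq // KS // /plus_prod big_geq // mul1n expr1; ring.
rewrite !(big_nat_recr r) //=; move/(_ (ltnW rn)): IH.
set S1 := \sum_(0 <= s < r) _; set S2 := \sum_(0 <= s < r) _.
rewrite !(KS 0%N) // (KS r.+1) //.
have -> : plus_prod x r.+1 = plus_prod x r * (1 + x ^+ r.+1).
  by rewrite /plus_prod big_nat_recr.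
have -> : minus_prod x n r = (1 - x ^+ r.+1) * minus_prod x n r.+1.
  by rewrite /minus_prod big_ltn.
have -> : (r.+1 * n.+2 = r.+1 * n.+1 + r.+1)%N by lia.
have -> : (r.+2 * n.+1 = r.+1 * n.+1 + n.+1)%N by lia.
rewrite ![x ^+ (_ + _)]exprD (exprS _ r.+1).
move: (x ^+ (r.+1 * n.+1)) (x ^+ n.+1) (x ^+ r.+1) ((-1) ^+ r.+1) => a b c e h.
by rewrite [2 * (S1 + _)]mulrDr addrA h; ring.
Qed.

(** The sum on the right is a multiple of x^(n+1), so as n grows this becomes Gauss's f_1^2 / f_2 =
    1 + 2t. *)
Lemma shanks_square (R : comNzRingType) (x : R) (n : nat) :
  plus_prod x n * (1 + 2 * \sum_(0 <= s < n) (-1) ^+ s.+1 * x ^+ (s.+1 ^ 2)) =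
  minus_prod x n 0%N + 2 * \sum_(0 <= s < n)
    (-1) ^+ s.+1 * x ^+ (s.+1 * n.+1) * plus_prod x s * minus_prod x n s.+1.
Proof.
elim: n => [|n IH]; first by rewrite /plus_prod /minus_prod !big_geq //; ring.
rewrite !(big_nat_recr n) //=.
have -> : minus_prod x n.+1 n.+1 = 1 by rewrite /minus_prod big_geq.
have := shanks_square_step x (leqnn n); rewrite /=.
set S1 := \sum_(0 <= s < n) _; set S2 := \sum_(0 <= s < n) _; rewrite -IH.
have -> : minus_prod x n n = 1 by rewrite /minus_prod big_geq.
move=> h.
have -> : plus_prod x n.+1 = plus_prod x n * (1 + x ^+ n.+1).
  by rewrite /plus_prod big_nat_recr.
rewrite [2 * (S1 + _)]mulrDr addrA h.
have -> : (n.+1 * n.+2 = n.+1 * n.+1 + n.+1)%N by lia.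
by rewrite exprD -mulnn; ring.
Qed.

(** The analogous telescoping for triangular numbers: up to one boundary term, passing from n to n+1
    multiplies the partial sum by 1 - x^(2n+1). *)
Lemma shanks_triangle_step (R : comNzRingType) (x : R) (n r : nat)
    (F := fun k t => \sum_(0 <= s < t)
       x ^+ (s * k.*2.+1) * odd_prod x s * even_prod x k s) :
  (r <= n)%N ->
  F n.+1 r.+1 = (1 - x ^+ n.*2.+1) * F n r.+1
                + x ^+ (r.+1 * n.*2.+1) * odd_prod x r.+1 * even_prod x n r.
Proof.
have VS s : (s <= n)%N -> even_prod x n.+1 s = even_prod x n s * (1 - x ^+ n.*2.+2).
  by move=> sn; rewrite /even_prod big_nat_recr.
have OS s : odd_prod x s.+1 = odd_prod x s * (1 - x ^+ s.*2.+1).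
  by rewrite /odd_prod big_nat_recr.
rewrite /F; elim: r => [_|r IH rn].
  have O0 : odd_prod x 0%N = 1 by rewrite /odd_prod big_geq.
  rewrite !big_nat1 VS // OS O0 mul0n mul1n !exprS; ring.
rewrite !(big_nat_recr r.+1) //= {}IH ?(ltnW rn) // VS // (OS r.+1).
have -> : even_prod x n r = (1 - x ^+ r.*2.+2) * even_prod x n r.+1.
  by rewrite /even_prod big_ltn.
have -> : (r.+1 * n.+1.*2.+1 = r.+1 * n.*2.+1 + r.*2.+2)%N by lia.
have -> : (r.+2 * n.*2.+1 = r.+1 * n.*2.+1 + n.*2.+1)%N by lia.
have -> : (r.+1.*2.+1 = r.*2.+2.+1)%N by lia.
rewrite !exprD !(exprS _ _.+1).
ring.
Qed.

(** Modulo x^(2n+1) only the term s = 0 survives on the right; the limit is Gauss's identity that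
    f_2^2 / f_1 is the generating series of the triangular numbers. *)
Lemma shanks_triangle (R : comNzRingType) (x : R) (n : nat) :
  odd_prod x n * \sum_(0 <= t < n.*2) x ^+ (t * t.+1)./2 =
  \sum_(0 <= s < n) x ^+ (s * n.*2.+1) * odd_prod x s * even_prod x n s.
Proof.
elim: n => [|n IH]; first by rewrite !big_geq // mulr0.
have := shanks_triangle_step x (leqnn n); rewrite /= => ->.
rewrite (big_nat_recr n) // -IH doubleS !(big_nat_recr n.*2.+1, big_nat_recr n.*2) //.
have -> : odd_prod x n.+1 = odd_prod x n * (1 - x ^+ n.*2.+1).
  by rewrite /odd_prod big_nat_recr.
have -> : even_prod x n n = 1 by rewrite /even_prod big_geq.
have -> : ((n.*2 * n.*2.+1)./2 = n * n.*2.+1)%N by rewrite -doubleMl doubleK.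
have -> : ((n.*2.+1 * n.*2.+2)./2 = n.+1 * n.*2.+1)%N.
  by rewrite -doubleS -doubleMr doubleK mulnC.
rewrite /=; ring.
Qed.

(** The series t cut after [n] terms; the classical theta series, summed over all integers, is 1 +
    2t. *)
Definition theta (n : nat) : {poly int} :=
  \sum_(0 <= s < n) (-1) ^+ s.+1 * 'X^(s.+1 ^ 2).

Definition triangles (n : nat) : {poly int} :=
  \sum_(0 <= t < n) 'X^((t * t.+1)./2).

Lemma gauss_square (k n N : nat) : (k <= n.+1)%N -> (k <= N.+1)%N ->
  eqmX 0 k (minus_prod 'X n 0) (plus_prod 'X n * (1 + 2 * theta N)).
Proof.
move=> kn kN; apply: (@eqmX_trans _ _ _ (plus_prod 'X n * (1 + 2 * theta n))).
  apply: eqmX_sym; rewrite shanks_square.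
  have [Q ->] : exists Q : {poly int}, \sum_(0 <= s < n)
    (-1) ^+ s.+1 * 'X ^+ (s.+1 * n.+1) * plus_prod 'X s * minus_prod 'X n s.+1
    = 'X^(n.+1) * Q.
    elim/big_ind: _ => [|x y [P ->] [Q ->]|s _].
    - by exists 0; rewrite mulr0.
    - by exists (P + Q); rewrite mulrDr.
    exists ((-1) ^+ s.+1 * 'X ^+ (s * n.+1) * plus_prod 'X s * minus_prod 'X n s.+1).
    by rewrite mulSn exprD; ring.
  by rewrite mulrCA; apply: eqmX_addXn.
apply: eqmX_mull; apply: eqmXD; first exact: eqmX_refl.
apply: eqmX_mull.
(* Both truncations are compared with [theta k.-1], whose omitted exponents are all at least k. *)
have h m : (k <= m.+1)%N -> eqmX 0 k (theta m) (theta k).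
  move=> km; suff h a : eqmX 0 k (theta (k.-1 + a)) (theta k.-1).
    apply: (@eqmX_trans _ _ _ (theta k.-1)).
      have -> : m = (k.-1 + (m - k.-1))%N by lia.
      exact: h.
    have := h (k - k.-1)%N; have -> : (k.-1 + (k - k.-1) = k)%N by lia.
    exact: eqmX_sym.
  elim: a => [|a IH]; first by rewrite addn0; apply: eqmX_refl.
  rewrite addnS /theta big_nat_recr //= mulrC.
  by apply: eqmX_trans IH; apply: eqmX_addXn; rewrite -mulnn; lia.
by apply: eqmX_trans (h _ kn) (eqmX_sym (h _ kN)).
Qed.

Lemma gauss_triangle (k n : nat) : (k <= n.*2)%N ->
  eqmX 0 k (even_prod 'X n 0) (odd_prod 'X n * triangles n.*2).
Proof.
case: n => [|n] kn; first by move=> i; lia.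
apply: eqmX_sym; rewrite shanks_triangle big_ltn // mul0n expr0 mul1r.
rewrite {1}/odd_prod big_geq // mul1r.
have [Q ->] : exists Q : {poly int}, \sum_(1 <= s < n.+1)
    'X ^+ (s * n.+1.*2.+1) * odd_prod 'X s * even_prod 'X n.+1 s
    = 'X^(n.+1.*2.+1) * Q.
  rewrite big_add1 /=; elim/big_ind: _ => [|x y [P ->] [Q ->]|s _].
  - by exists 0; rewrite mulr0.
  - by exists (P + Q); rewrite mulrDr.
  exists ('X ^+ (s * n.+1.*2.+1) * odd_prod 'X s.+1 * even_prod 'X n.+1 s.+1).
  by rewrite mulSn exprD; ring.
by apply: eqmX_addXn; lia.
Qed.

(** * Coloured overpartitions *)

(** A truncation of (1 + q^j) / (1 - q^j): a part that is present counts twice, as its first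
    occurrence may be overlined or not. *)
Definition overpart_poly (n j : nat) : {poly int} :=
  \sum_(i < n.+1) (if i == 0%N :> nat then 1 else 2)%:P * 'X^(i * j).

(** Distributing the product chooses the multiplicities. Each choice has weight 2 to the number of
    parts present, which is the number of sets of overlined parts compatible with it. *)
Lemma abar_coef (s n : nat) :
  (abar s n)%:Z =
  (\prod_(x : cpart s n) (if allowed x then overpart_poly n (psize x) else 1))`_n.
Proof.
(* The weight 0 excludes forbidden parts, so that all coloured parts share one range of
   multiplicities. *)
pose w (x : cpart s n) (i : 'I_n.+1) : int :=
  if i == 0%N :> nat then 1 else if allowed x then 2 else 0.
have -> : \prod_(x : cpart s n)
    (if allowed x then overpart_poly n (psize x) else 1) =
  \prod_(x : cpart s n) \sum_(i < n.+1) (w x i)%:P * 'X^(i * psize x).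
  apply: eq_bigr => x _; rewrite /overpart_poly /w; case: ifP => // _.
  rewrite big_ord_recl mul0n expr0 mulr1 big1 ?addr0 // => i _.
  by rewrite /= mul0r.
rewrite bigA_distr_bigA coef_sum.
have wE (f : {ffun cpart s n -> 'I_n.+1}) :
  (\prod_x ((w x (f x))%:P * 'X^(f x * psize x)))`_n =
  if [forall x, (0 < f x)%N ==> allowed x] && (\sum_x f x * psize x == n)%N
  then (2 ^ #|[set x | (0 < f x)%N]|)%N%:Z else 0.
  rewrite big_split /= -rmorph_prod coefCM -expr_sum coefXn eq_sym.
  case: eqP => [_|_]; last by rewrite mulr0 andbF.
  rewrite mulr1 andbT; case: ifP => [/forallP h|/negbT].
    rewrite (eq_bigr (fun x => if x \in [set x | (0 < f x)%N] then 2 else 1)).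
      by rewrite -big_mkcond prodr_const -natz natrX.
    move=> x _; rewrite inE /w lt0n; move: (h x).
    by rewrite lt0n; case: eqP => //= _ ->.
  rewrite negb_forall => /existsP[x]; rewrite negb_imply => /andP[fx ax].
  by rewrite (bigD1 x) //= /w (negbTE ax) gtn_eqF // mul0r.
rewrite (eq_bigr _ (fun f _ => wE f)) -big_mkcond /=.
rewrite /abar -sum1_card /colored_overpartitions.
transitivity (\sum_(f : {ffun cpart s n -> 'I_n.+1} |
    [forall x, (0 < f x)%N ==> allowed x] && (\sum_x f x * psize x == n)%N)
    \sum_(O : {set cpart s n} | O \subset [set x | (0 < f x)%N]) 1)%N%:Z.
  rewrite pair_big_dep /=; congr (Posz _); apply: eq_bigl => -[f O] /=.
  rewrite inE /= -andbA andbCA andbA [X in X && _]andbC -andbA; congr andb.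
  rewrite andbC; congr andb.
  apply/forall_inP/subsetP => h x; last by move/h; rewrite inE.
  by rewrite inE; apply: h.
rewrite -natz natr_sum; apply: eq_bigr => f _; rewrite natz; congr Posz.
rewrite -card_powerset -sum1_card; apply: eq_bigl => O.
by rewrite inE.
Qed.

Lemma overpart_poly_mul (n j : nat) : (0 < j)%N ->
  eqmX 0 n.+1 (overpart_poly n j * (1 - 'X^j)) (1 + 'X^j).
Proof.
move=> j_gt0.
have -> : overpart_poly n j * (1 - 'X^j) = 1 + 'X^j + 'X^(n.+1 * j) * (-2%:P).
  have -> : 2%:P = 2 :> {poly int} by rewrite rmorph_nat.
  rewrite /overpart_poly; elim: n => [|n IH].
    by rewrite big_ord1 /= mul0n mul1n expr0 rmorph1; ring.
  rewrite big_ord_recr /= mulrDl IH [(n.+2 * j)%N]mulSn exprD rmorph_nat.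
  ring.
by apply: eqmX_addXn; rewrite leq_pmulr.
Qed.

(** Odd sizes come in s colours and even sizes in one; s - 1 further copies of the even sizes
    equalize the exponents without dividing. The index j stands for the size j + 1, so [odd j]
    selects even sizes. *)
Lemma prod_allowed (R : comNzRingType) (s n : nat) (f : nat -> R) :
  (0 < s)%N ->
  \prod_(x : cpart s n) (if allowed x then f (psize x) else 1) *
    (\prod_(j < n | odd j) f j.+1) ^+ s.-1 = (\prod_(0 <= j < n) f j.+1) ^+ s.
Proof.
case: s => // s _; rewrite /= big_mkord -!prodrXl.
rewrite [in X in _ * X]big_mkcond /=.
rewrite -(pair_big predT predT (fun (j : 'I_n) (k : 'I_s.+1) =>
  if allowed (j, k) then f (psize (j, k)) else 1)) /= -big_split /=.
apply: eq_bigr => j _; rewrite /allowed /psize /=; case: (odd j) => /=.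
  by rewrite big_ord_recl /= big1 // mulr1 exprS.
by rewrite prodr_const cardT size_enum_ord mulr1.
Qed.

Lemma prod_odd_index (R : comNzRingType) (n : nat) (f : nat -> R) :
  \prod_(j < n | odd j) f j.+1 = \prod_(0 <= i < n./2) f i.*2.+2.
Proof.
elim: n => [|n IH]; first by rewrite big_ord0 big_geq.
rewrite big_mkcond big_ord_recr -big_mkcond IH /= uphalf_half.
case: (boolP (odd n)) => on; last by rewrite mulr1.
by rewrite big_nat_recr //= -[in f n.+1](odd_double_half n) on.
Qed.

(** The generating function factors as (f_2^2 / f_4)^(s-1) (f_2 / f_1^2)^s, and Gauss's identity, in
    q^2 and in q, rewrites both factors. The denominator is cleared to stay within polynomials. *)
Lemma abar_gf (s n N : nat) : (0 < s)%N -> (n <= N)%N ->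
  exists2 G : {poly int}, G`_n = (abar s n)%:Z &
    eqmX 0 n.+1 (G * (1 + 2 * theta N) ^+ s)
                ((1 + 2 * (theta N \Po 'X^2)) ^+ s.-1).
Proof.
move=> s_gt0 nN; rewrite abar_coef; set G := \prod_x _; exists G => //.
pose e j : {poly int} := 1 - 'X^j; pose d j : {poly int} := 1 + 'X^j.
pose T (f : nat -> {poly int}) :=
  \prod_(x : cpart s n) (if allowed x then f (psize x) else 1).
pose Ev (f : nat -> {poly int}) := \prod_(j < n | odd j) f j.+1.
have h1 : eqmX 0 n.+1 (G * T e) (T d).
  rewrite /G /T -big_split /=; apply: eqmX_prod => x _.
  case: ifP => _; last by rewrite mulr1; apply: eqmX_refl.
  exact: overpart_poly_mul.
have eT : T e * Ev e ^+ s.-1 = minus_prod 'X n 0 ^+ s by apply: prod_allowed.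
have dT : T d * Ev d ^+ s.-1 = plus_prod 'X n ^+ s by apply: prod_allowed.
have h2 : eqmX 0 n.+1 (Ev e) (Ev d * (1 + 2 * (theta N \Po 'X^2))).
  rewrite /Ev !prod_odd_index.
  (* Even sizes up to n are the doubles of sizes up to n/2, so this is Gauss's identity in q^2;
     doubling the precision n/2 + 1 reaches at least n + 1. *)
  have /eqmX_comp : eqmX 0 (n./2).+1 (minus_prod 'X n./2 0)
     (plus_prod 'X n./2 * (1 + 2 * theta N)) by apply: gauss_square; lia.
  rewrite /minus_prod /plus_prod rmorphM !rmorph_prod rmorphD rmorphM /=.
  rewrite rmorph1 rmorph_nat.
  have E i : (1 - 'X^(i.+1)) \Po 'X^2 = e i.*2.+2.
    by rewrite rmorphB rmorph1 rmorphXn /= comp_polyX -exprM /e mul2n.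
  have D i : (1 + 'X^(i.+1)) \Po 'X^2 = d i.*2.+2.
    by rewrite rmorphD rmorph1 rmorphXn /= comp_polyX -exprM /d mul2n.
  under eq_bigr do rewrite E; under [in X in eqmX _ _ _ X]eq_bigr do rewrite D.
  by apply: eqmX_weak; lia.
have h3 : eqmX 0 n.+1 (minus_prod 'X n 0) (plus_prod 'X n * (1 + 2 * theta N)).
  exact: gauss_square.
(* All divisions are deferred to this one cancellation, by a product with constant term 1. *)
apply: (@eqmX_cancel _ _ _ _ (plus_prod 'X n ^+ s * Ev d ^+ s.-1)).
  have Xp j : ('X^(j.+1) : {poly int})`_0 = 0 by rewrite coefXn.
  have XX (P : {poly int}) k : P`_0 = 1 -> (P ^+ k)`_0 = 1.
    by move=> hP; elim: k => [|k IH]; rewrite ?coef1 // exprS coef0M hP IH mulr1.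
  have d0 j : (d j.+1)`_0 = 1 by rewrite coefD coef1 Xp addr0.
  rewrite coef0M !XX ?mulr1 //.
    by rewrite /plus_prod coef0_prod big1 // => j _; apply: d0.
  by rewrite /Ev coef0_prod big1 // => j _; apply: d0.
have -> : G * (1 + 2 * theta N) ^+ s * (plus_prod 'X n ^+ s * Ev d ^+ s.-1) =
  G * Ev d ^+ s.-1 * (plus_prod 'X n * (1 + 2 * theta N)) ^+ s by rewrite exprMn; ring.
have -> : (1 + 2 * (theta N \Po 'X^2)) ^+ s.-1 * (plus_prod 'X n ^+ s * Ev d ^+ s.-1)
  = plus_prod 'X n ^+ s * (Ev d * (1 + 2 * (theta N \Po 'X^2))) ^+ s.-1.
  by rewrite exprMn; ring.
apply: eqmX_trans; first by apply: eqmX_mull; apply: eqmXX; apply: eqmX_sym h3.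
apply: eqmX_sym; apply: eqmX_trans.
  by apply: eqmX_mull; apply: eqmXX; apply: eqmX_sym h2.
rewrite -eT -dT.
have -> : T d * Ev d ^+ s.-1 * Ev e ^+ s.-1 = T d * (Ev d ^+ s.-1 * Ev e ^+ s.-1).
  by ring.
have -> : G * Ev d ^+ s.-1 * (T e * Ev e ^+ s.-1)
   = G * T e * (Ev d ^+ s.-1 * Ev e ^+ s.-1) by ring.
by apply: eqmX_mulr; apply: eqmX_sym.
Qed.

(** * Coefficients of products of theta series at exponents 5 modulo 8 *)

Definition twosq_count (N : nat) : nat :=
  #|[set z : 'I_N * 'I_N | (z.1.*2.+1 ^ 2 + z.2.+1.*2 ^ 2 == N)%N]|.

Definition odd_squares (n : nat) : {poly int} :=
  \sum_(0 <= i < n) 'X^(i.*2.+1 ^ 2).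

Definition even_squares (n : nat) : {poly int} :=
  \sum_(0 <= i < n) 'X^(i.+1.*2 ^ 2).

Lemma theta_double n : theta n.*2 = even_squares n - odd_squares n.
Proof.
rewrite /theta /even_squares /odd_squares.
elim: n => [|n IH]; first by rewrite !big_geq // subr0.
rewrite doubleS !(big_nat_recr n.*2.+1, big_nat_recr n.*2) // IH.
rewrite !(big_nat_recr n) //= -!(signr_odd _ _.+1) /= odd_double /=; ring.
Qed.

Lemma coef_sumXn_mul (n m N : nat) (e f : nat -> nat) :
  ((\sum_(0 <= i < n) 'X^(e i)) * (\sum_(0 <= j < m) 'X^(f j)) : {poly int})`_N
  = #|[set z : 'I_n * 'I_m | (e z.1 + f z.2 == N)%N]|%:Z.
Proof.
rewrite !big_mkord big_distrlr /= pair_big /= coef_sum -sum1_card.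
rewrite -natz natr_sum big_mkcond [RHS]big_mkcond; apply: eq_bigr => -[i j] _ /=.
by rewrite inE -exprD coefXn eq_sym /=; case: eqP.
Qed.

Lemma coef_sum_signXn_mul0 (n m N : nat) (a b : nat -> {poly int}) (e f : nat -> nat) :
  (forall i j, (e i + f j)%N != N) ->
  (forall i, size (a i) <= 1)%N -> (forall i, size (b i) <= 1)%N ->
  ((\sum_(0 <= i < n) a i * 'X^(e i)) * (\sum_(0 <= j < m) b j * 'X^(f j)))`_N = 0.
Proof.
move=> ef sa sb; rewrite big_distrlr /= coef_sum big1 // => i _.
rewrite coef_sum big1 // => j _.
rewrite mulrACA (size1_polyC (sa i)) (size1_polyC (sb j)) -rmorphM coefCM.
by rewrite -exprD coefXn eq_sym (negbTE (ef i j)) mulr0.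
Qed.

Lemma coef_comp_X2_odd (P : {poly int}) N : odd N -> (P \Po 'X^2)`_N = 0.
Proof. by move=> oN; rewrite coef_comp_poly_Xn // dvdn2 oN. Qed.

Lemma sqr_mod8 x : ((x ^ 2) %% 8 = if odd x then 1 else if odd x./2 then 4 else 0)%N.
Proof.
rewrite -[in LHS](odd_double_half x) -[in LHS](odd_double_half x./2).
rewrite -mulnn; case: (odd x); case: (odd x./2) => /=; nia.
Qed.

(** 5 is not a square modulo 8. *)
Lemma coef_theta N : (N %% 8 = 5)%N -> (theta N.*2)`_N = 0.
Proof.
move=> N5; rewrite coef_sum big1 // => i _.
rewrite -signr_odd -polyC1 -polyCN -rmorphXn coefCM coefXn.
case: eqP => [h|_]; last by rewrite mulr0.
by have := sqr_mod8 i.+1; rewrite -h N5; case: ifP => //; case: ifP.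
Qed.

(** With t = v - u, split into even and odd squares, only the cross term -2uv has odd exponents.
    Cutting t at [N.*2] leaves N squares of each parity, as in [twosq_count]. *)
Lemma coef_theta_sq N : odd N ->
  (theta N.*2 ^+ 2)`_N = - (2 * twosq_count N)%N%:Z.
Proof.
move=> oN; rewrite theta_double.
set u := odd_squares N; set v := even_squares N.
have -> : (v - u) ^+ 2 = v * v + u * u - (v * u + v * u) by ring.
have z (n m : nat) (e f : nat -> nat) : (forall i j, (e i + f j)%N != N) ->
  ((\sum_(0 <= i < n) 'X^(e i)) * (\sum_(0 <= j < m) 'X^(f j)) : {poly int})`_N = 0.
  move=> ef; rewrite coef_sumXn_mul; apply/eqP; rewrite eqz_nat cards_eq0.
  by apply/eqP/setP => -[i j]; rewrite !inE (negbTE (ef _ _)).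
rewrite coefB !coefD.
rewrite z; last first.
  by move=> i j; apply/eqP => h; have := oN; rewrite -h oddD !oddX !odd_double.
rewrite z; last first.
  by move=> i j; apply/eqP => h; have := oN; rewrite -h oddD !oddX /= !odd_double.
rewrite [v * u]mulrC coef_sumXn_mul -/(twosq_count N); lia.
Qed.

Lemma theta_signE n :
  theta n = \sum_(0 <= s < n) ((-1) ^+ s.+1)%:P * 'X^(s.+1 ^ 2).
Proof. by apply: eq_bigr => i _; rewrite rmorphXn rmorphN rmorph1. Qed.

Lemma comp_thetaE n k : theta n \Po 'X^k =
  \sum_(0 <= s < n) ((-1) ^+ s.+1)%:P * 'X^(k * s.+1 ^ 2).
Proof.
rewrite theta_signE rmorph_sum; apply: eq_bigr => i _.
by rewrite rmorphM /= comp_polyC comp_Xn_poly -exprM.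
Qed.

(** 2a^2 + b^2 is never 5 modulo 8. *)
Lemma coef_comp_theta_mul N n : (N %% 8 = 5)%N ->
  ((theta n \Po 'X^2) * theta n)`_N = 0.
Proof.
move=> N5; rewrite comp_thetaE theta_signE; apply: coef_sum_signXn_mul0.
- move=> i j; apply/eqP => h.
  have := sqr_mod8 i.+1; have := sqr_mod8 j.+1; have := N5; rewrite -h.
  by do 4?case: ifP => _; lia.
- by move=> i; apply: size_polyC_leq1.
- by move=> i; apply: size_polyC_leq1.
Qed.

Lemma dvdz_coef_eqmX d N (P Q : {poly int}) :
  eqmX d N.+1 P Q -> Q`_N = 0 -> (d %| P`_N)%Z.
Proof. by move=> h Q0; have := h N (leqnn _); rewrite Q0 subr0. Qed.

Lemma coef_comp_X2_mul_odd (P Q : {poly int}) N : odd N ->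
  ((P \Po 'X^2) * (Q \Po 'X^2))`_N = 0.
Proof. by move=> oN; rewrite -rmorphM /= coef_comp_X2_odd. Qed.

(** Modulo 2, t^4 is t(q^2)^2, which has only even exponents. The next two lemmas reduce squares in
    the same way. *)
Lemma coef_theta4 N n : odd N -> (2 %| (theta n ^+ 4)`_N)%Z.
Proof.
move=> oN; apply: dvdz_coef_eqmX (coef_comp_X2_mul_odd (theta n) (theta n) oN).
by rewrite (exprD _ 2 2); apply: eqmXM; apply: eqmX_frobenius.
Qed.

Lemma coef_comp_theta_sq N n : odd N ->
  (2 %| ((theta n \Po 'X^2) * theta n ^+ 2)`_N)%Z.
Proof.
move=> oN; apply: dvdz_coef_eqmX (coef_comp_X2_mul_odd (theta n) (theta n) oN).
by apply: eqmX_mull; apply: eqmX_frobenius.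
Qed.

Lemma coef_theta3 N n : (N %% 8 = 5)%N -> (2 %| (theta n ^+ 3)`_N)%Z.
Proof.
move=> N5; apply: dvdz_coef_eqmX (coef_comp_theta_mul n N5).
by rewrite exprSr; apply: eqmX_mulr; apply: eqmX_frobenius.
Qed.

(** Modulo 2, t(q^2)^2 is t(q^4), whose exponents 4i^2 are the even squares and whose signs
    disappear. *)
Lemma even_squares_mod2 N :
  eqmX 2 N.+1 ((theta N.*2 \Po 'X^2) ^+ 2) (even_squares N).
Proof.
apply: eqmX_trans; first exact: eqmX_frobenius.
have -> : (theta N.*2 \Po 'X^2) \Po 'X^2 = theta N.*2 \Po 'X^4.
  by rewrite -comp_polyA comp_Xn_poly -exprM.
(* The terms with s >= N have exponent 4(s+1)^2 > N and drop out. *)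
rewrite comp_thetaE -addnn (@big_cat_nat _ _ _ N) ?leq_addr //=.
have [Q ->] : exists Q : {poly int}, \sum_(N <= s < N + N)
    ((-1) ^+ s.+1)%:P * 'X^(4 * s.+1 ^ 2) = 'X^(N.+1) * Q.
  rewrite big_seq; elim/big_ind: _ => [|x y [P ->] [Q ->]|s].
  - by exists 0; rewrite mulr0.
  - by exists (P + Q); rewrite mulrDr.
  rewrite mem_index_iota => /andP[Ns _].
  exists (((-1) ^+ s.+1)%:P * 'X^(4 * s.+1 ^ 2 - N.+1)).
  by rewrite mulrCA -exprD subnKC // -mulnn; nia.
apply: eqmX_trans; first exact: eqmX_addXn.
suff h k : eqmX 2 N.+1 (\sum_(0 <= s < k) ((-1) ^+ s.+1)%:P * 'X^(4 * s.+1 ^ 2))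
    (even_squares k) by exact: h.
rewrite /even_squares; elim: k => [|k IH].
  by rewrite !big_geq //; apply: eqmX_refl.
rewrite !big_nat_recr //=; apply: eqmXD => //.
have -> : (k.+1.*2 ^ 2 = 4 * k.+1 ^ 2)%N by rewrite -!mulnn -muln2; lia.
rewrite -signr_odd; case: (odd _); last first.
  by rewrite expr0 rmorph1 mul1r; apply: eqmX_refl.
rewrite expr1 rmorphN rmorph1 mulN1r.
have -> : - 'X^(4 * k.+1 ^ 2) =
    'X^(4 * k.+1 ^ 2) + 2%:P * (- 'X^(4 * k.+1 ^ 2)) :> {poly int}.
  by rewrite rmorph_nat; ring.
exact: eqmX_multX.
Qed.

(** Modulo 2 the product is (v - u)v. Here v^2 has only even exponents, and the coefficient of uv is
    C(N). *)
Lemma coef_theta_comp_sq N : odd N -> ~~ odd (twosq_count N) ->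
  (2 %| (theta N.*2 * (theta N.*2 \Po 'X^2) ^+ 2)`_N)%Z.
Proof.
move=> oN Ceven.
have h2 := eqmX_mull (theta N.*2) (@even_squares_mod2 N).
have := h2 N (leqnn _); rewrite rpredBr //.
rewrite theta_double mulrBl -expr2 coefB.
have ev : even_squares N = (\sum_(0 <= i < N) 'X^(2 * i.+1 ^ 2)) \Po 'X^2.
  rewrite rmorph_sum; apply: eq_bigr => i _ /=.
  by rewrite comp_Xn_poly -exprM; congr 'X^_; rewrite -!mulnn -muln2; lia.
rewrite {1}ev -rmorphXn /= coef_comp_X2_odd // sub0r rpredN.
by rewrite coef_sumXn_mul -/(twosq_count N) dvdzE dvdn2 Ceven.
Qed.

(** * Powers of 1 + 2t to the needed 2-adic precision, and divisibility of [abar] *)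

Lemma exp_one_add (R : comNzRingType) (x : R) (n : nat) :
  exists Y, (1 + x) ^+ n = 1 + n%:R * x + x ^+ 2 * Y.
Proof.
elim: n => [|n [Y IH]]; first by exists 0; rewrite expr0; ring.
exists (n%:R + Y + x * Y); rewrite exprS IH -natr1; ring.
Qed.

(** Tracks the bracket modulo 4. Squaring replaces the bracket U by U + 2^(m+1) U^2, and U^2 = t^2 +
    t^4 modulo 2, so that only the multiplier [e] changes. *)
Lemma exp_one_add2t (R : comNzRingType) (t : R) (m a : nat) :
  exists (e : nat) Y, (1 + 2 * t) ^+ (2 ^ m.+1 * a) =
    1 + 2 ^+ m.+2 * (a%:R * (t + t ^+ 2) + 2 * e%:R * (t ^+ 2 + t ^+ 4) + 4 * Y).
Proof.
have [e [Y h]] : exists (e : nat) (Y : R), (1 + 2 * t) ^+ (2 ^ m.+1) =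
    1 + 2 ^+ m.+2 * ((t + t ^+ 2) + 2 * e%:R * (t ^+ 2 + t ^+ 4) + 4 * Y).
  elim: m => [|m [e [Y IH]]]; first by exists 0%N, 0; rewrite expn1; ring.
  set U := _ + 4 * Y in IH.
  pose V := t ^+ 3 + 2 * (t + t ^+ 2) * (e%:R * (t ^+ 2 + t ^+ 4) + 2 * Y)
    + 2 * (e%:R * (t ^+ 2 + t ^+ 4) + 2 * Y) ^+ 2.
  have UE : U ^+ 2 = t ^+ 2 + t ^+ 4 + 2 * V by rewrite /V /U; ring.
  exists (e + 2 ^ m)%N, (Y + 2 ^+ m * V).
  rewrite expnSr exprM IH natrD natrX.
  have -> : (1 + 2 ^+ m.+2 * U) ^+ 2 = 1 + 2 ^+ m.+3 * (U + 2 ^+ m.+1 * U ^+ 2).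
    by rewrite !(exprS 2); move: (2 ^+ m) => q; ring.
  by rewrite UE /U !(exprS 2); move: (2 ^+ m) => q; ring.
have [Z hZ] := exp_one_add
  (2 ^+ m.+2 * ((t + t ^+ 2) + 2 * e%:R * (t ^+ 2 + t ^+ 4) + 4 * Y)) a.
exists (a * e)%N, (a%:R * Y + 2 ^+ m *
 ((t + t ^+ 2) + 2 * e%:R * (t ^+ 2 + t ^+ 4) + 4 * Y) ^+ 2 * Z).
by rewrite exprM h hZ natrM !(exprS 2); move: (2 ^+ m) => q; ring.
Qed.

Lemma coefMnat (k : nat) (P : {poly int}) i : (k%:R * P)`_i = k%:R * P`_i.
Proof. by rewrite -(rmorph_nat polyC) coefCM. Qed.

(** The exponent of 2 is shifted to m + 1. With W = (1 + 2t(q^2))^(s-1), the series is W / (1 +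
    2^(m+2) U). Since W has only even exponents, it remains to show that 4 divides the coefficient
    of W U. *)
Lemma abar_even_dvd (m a N : nat) : (0 < a)%N -> (N %% 8 = 5)%N ->
  ~~ odd (twosq_count N) -> (2 ^ m.+4 %| abar (2 ^ m.+1 * a) N)%N.
Proof.
move=> a_gt0 N5 Ceven; set s := (2 ^ m.+1 * a)%N.
have s_gt0 : (0 < s)%N by rewrite muln_gt0 expn_gt0.
have N2 : (N <= N.*2)%N by lia.
have oN : odd N by lia.
have [G GN h] := abar_gf s_gt0 N2.
have [e [Y hA]] := exp_one_add2t (theta N.*2) m a.
rewrite -/s in hA; rewrite hA in h.
set t := theta N.*2 in h hA; set w := t \Po 'X^2 in h.
set U := (_ + 4 * Y) in h hA.
have [Z hZ] := exp_one_add (2 * w) s.-1.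
set W := (1 + 2 * w) ^+ s.-1 in h hZ.
have WN : W`_N = 0.
  have -> : W = (1 + 2 * t) ^+ s.-1 \Po 'X^2.
    by rewrite rmorphXn rmorphD rmorphM rmorph1 rmorph_nat.
  by apply: coef_comp_X2_odd; lia.
have WUN : (4 %| (W * U)`_N)%Z.
  (* At N the terms t and w t vanish, and those behind a factor 2 are even. Only a t^2, with
     coefficient -2a C(N), uses the parity of C(N). *)
  have -> : W * U = a%:R * t + a%:R * t ^+ 2 + 2%:R * (e%:R * t ^+ 2)
      + 2%:R * (e%:R * t ^+ 4) + 2%:R * ((s.-1 * a)%:R * (w * t))
      + 2%:R * ((s.-1 * a)%:R * (w * t ^+ 2))
      + 4%:R * (W * Y + s.-1%:R * w * e%:R * (t ^+ 2 + t ^+ 4)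
         + w ^+ 2 * Z * (a%:R * (t + t ^+ 2) + 2 * e%:R * (t ^+ 2 + t ^+ 4))).
    rewrite /U mulrDr {1}hZ natrM; ring.
  have t2 : (4 %| (t ^+ 2)`_N)%Z.
    by rewrite coef_theta_sq // rpredN dvdzE /=; lia.
  have m2 k x : (2 %| x)%Z -> (4 %| 2%:R * (k%:R * x))%Z.
    by move=> ?; rewrite (@dvdz_mul 2 2) // dvdz_mull.
  rewrite !coefD !coefMnat /t coef_theta // coef_comp_theta_mul // !mulr0 add0r addr0.
  rewrite !rpredD ?m2 ?coef_theta4 ?coef_comp_theta_sq //.
  - exact: dvdz_mull.
  - exact: dvdz_trans t2.
  - exact: dvdz_mulr.
(* Since (1 + x)(1 - x) = 1 - x^2, this factor inverts 1 + 2^(m+2) U modulo 2^(2m+4). *)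
have := eqmX_mulr (1 - 2 ^+ m.+2 * U) h => /(_ N (leqnn _)).
rewrite dvd0z subr_eq0 => /eqP.
have -> : G * (1 + 2 ^+ m.+2 * U) * (1 - 2 ^+ m.+2 * U)
  = G - ((2 ^ m.+4 * 2 ^ m)%N%:R * (G * U ^+ 2)).
  by rewrite natrM !natrX !(exprS 2); move: (2 ^+ m) => q; ring.
have -> : W * (1 - 2 ^+ m.+2 * U) = W - (2 ^ m.+2)%N%:R * (W * U).
  by rewrite natrX; ring.
rewrite !coefB !coefMnat WN GN => E.
have : ((2 ^ m.+4)%N%:Z %| (abar s N)%:Z)%Z.
  rewrite -(subrK ((2 ^ m.+4 * 2 ^ m)%:R * (G * U ^+ 2)`_N) (abar s N)%:Z) E.
  rewrite sub0r rpredD ?rpredN //.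
    have -> : ((2 ^ m.+4)%N%:Z = (2 ^ m.+2)%N%:R * 4) by rewrite natz !expnS; lia.
    by apply: dvdz_mul.
  by rewrite natrM -mulrA dvdz_mulr // natz.
by rewrite dvdzE.
Qed.

(** As (1 + 2t)^2 = 1 + 4(t + t^2), the inverse of (1 + 2t)^(2b+1) modulo 16 is (1 + 2t)(1 -
    4(b+1)(t + t^2)); the power of 1 + 2w becomes 1 + 4b(w + w^2). *)
Lemma abar_odd_dvd (b N : nat) : (N %% 8 = 5)%N ->
  ~~ odd (twosq_count N) -> (16 %| abar b.*2.+1 N)%N.
Proof.
move=> N5 Ceven.
have N2 : (N <= N.*2)%N by lia.
have oN : odd N by lia.
have [G GN h] := abar_gf (ltn0Sn b.*2) N2; rewrite [b.*2.+1.-1]/= in h.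
set t := theta N.*2 in h; set w := t \Po 'X^2 in h.
have [Y hA] := exp_one_add (4 * (t + t ^+ 2)) b.+1.
have [Z hB] := exp_one_add (4 * (w + w ^+ 2)) b.
have h16 : eqmX 16 N.+1 G ((1 + 2 * t) * (1 + 4 * b%:R * (w + w ^+ 2))
    * (1 - 4 * b.+1%:R * (t + t ^+ 2))).
  have e16 : 16%:P = 16 :> {poly int} by rewrite rmorph_nat.
  pose F := (1 + 2 * t) * (1 - 4 * b.+1%:R * (t + t ^+ 2)).
  have h1 : eqmX 16 N.+1 (G * (1 + 2 * t) ^+ b.*2.+1 * F) ((1 + 2 * w) ^+ b.*2 * F).
    by apply: eqmX_mulr; apply: eqmX0.
  have -> : (1 + 2 * t) * (1 + 4 * b%:R * (w + w ^+ 2))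
    * (1 - 4 * b.+1%:R * (t + t ^+ 2)) = (1 + 2 * w) ^+ b.*2 * F
    + 16%:P * (- (w + w ^+ 2) ^+ 2 * Z * F).
    have -> : (1 + 2 * w) ^+ b.*2 = (1 + 4 * (w + w ^+ 2)) ^+ b.
      by rewrite -mul2n exprM; congr (_ ^+ b); ring.
    by rewrite hB /F e16; ring.
  apply: eqmX_sym; apply: eqmX_trans; first exact: eqmX_multX.
  apply: eqmX_trans; first exact: eqmX_sym h1.
  have -> : G * (1 + 2 * t) ^+ b.*2.+1 * F = G + 16%:P * (G *
     ((t + t ^+ 2) ^+ 2 * Y * (1 - 4 * b.+1%:R * (t + t ^+ 2))
      - b.+1%:R ^+ 2 * (t + t ^+ 2) ^+ 2)).
    have -> : G * (1 + 2 * t) ^+ b.*2.+1 * F =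
      G * ((1 + 4 * (t + t ^+ 2)) ^+ b.+1 * (1 - 4 * b.+1%:R * (t + t ^+ 2))).
      have -> : (1 + 4 * (t + t ^+ 2)) ^+ b.+1 = (1 + 2 * t) ^+ b.*2.+1 * (1 + 2 * t).
        rewrite -exprSr -doubleS -mul2n exprM; congr (_ ^+ b.+1); ring.
      by rewrite /F; ring.
    by rewrite hA e16; ring.
  exact: eqmX_multX.
have := h16 N (leqnn _).
(* The factor 3 collects -4 and -8 in front of (b+1) t^2. The parity of C(N) enters through t^2 and
   t w^2. *)
have -> : (1 + 2 * t) * (1 + 4 * b%:R * (w + w ^+ 2)) * (1 - 4 * b.+1%:R * (t + t ^+ 2))
  = 1 + 2%:R * t + 4%:R * (b%:R * w) + 4%:R * (b%:R * w ^+ 2)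
    + 8%:R * (b%:R * (w * t)) + 8%:R * (b%:R * (t * w ^+ 2))
    - 4%:R * (b.+1%:R * t) - 4%:R * ((3 * b.+1)%N%:R * t ^+ 2)
    - 8%:R * (b.+1%:R * t ^+ 3)
    + 16%:R * (- b%:R * b.+1%:R * (1 + 2 * t) * (w + w ^+ 2) * (t + t ^+ 2)).
  by rewrite natrM; ring.
have w0 : w`_N = 0 by apply: coef_comp_X2_odd; lia.
have w20 : (w ^+ 2)`_N = 0 by rewrite -rmorphXn; apply: coef_comp_X2_odd; lia.
have N1 : (1 : {poly int})`_N = 0.
  by rewrite coef1; case: eqP => // N0; rewrite N0 in N5.
rewrite GN !(coefD, coefN) !coefMnat w0 w20 N1 /t coef_theta // coef_comp_theta_mul //.
rewrite !mulr0 !(add0r, addr0, oppr0).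
have t2 : (4 %| (theta N.*2 ^+ 2)`_N)%Z.
  by rewrite coef_theta_sq // rpredN dvdzE /=; lia.
rewrite rpredBr; first by rewrite dvdzE.
have m8 k x : (2 %| x)%Z -> (16 %| 8%:R * (k%:R * x))%Z.
  by move=> ?; rewrite (@dvdz_mul 8 2) // dvdz_mull.
rewrite rpredD //; last by rewrite dvdz_mulr.
rewrite rpredB ?m8 ?coef_theta3 // rpredB ?m8 ?coef_theta_comp_sq //.
by rewrite (@dvdz_mul 4 4) // dvdz_mull.
Qed.

(** * Parity of the coefficients of f_1^3 f_2^6 *)

Lemma psmul_coef (a b : nat -> int) (A B : {poly int}) n :
  (forall i, (i <= n)%N -> a i = A`_i) -> (forall i, (i <= n)%N -> b i = B`_i) ->
  forall i, (i <= n)%N -> psmul a b i = (A * B)`_i.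
Proof.
move=> ha hb i ni; rewrite coefM; apply: eq_bigr => j _.
by rewrite ha ?hb //; have := ltn_ord j; lia.
Qed.

Lemma psexp_coef (a : nat -> int) (A : {poly int}) n e :
  (forall i, (i <= n)%N -> a i = A`_i) ->
  forall i, (i <= n)%N -> psexp a e i = (A ^+ e)`_i.
Proof.
move=> ha; elim: e => [|e IH] i ni; first by rewrite expr0 coef1.
by rewrite exprS; apply: psmul_coef ni.
Qed.

Lemma c_coef (n L : nat) : (n <= L)%N ->
  c n = (minus_prod 'X L 0 ^+ 3 * (minus_prod 'X L 0 \Po 'X^2) ^+ 6)`_n.
Proof.
move=> nL; apply: (psmul_coef (n := n)) => // i ni;
  apply: (psexp_coef (n := n)) => // k kn.
  rewrite -(@coef_euler_partial 1 k L) ?(leq_trans kn) //.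
  rewrite /euler_partial /minus_prod big_add1.
  by congr (polyseq _)`_k; apply: eq_bigr => j _; rewrite mul1n.
rewrite -(@coef_euler_partial 2 k L) ?(leq_trans kn) //.
rewrite /euler_partial /minus_prod big_add1 rmorph_prod.
congr (polyseq _)`_k; apply: eq_bigr => j _.
by rewrite rmorphB rmorph1 /= comp_Xn_poly -exprM.
Qed.

Lemma minus_prod_comp_X2 K :
  minus_prod 'X K 0 \Po 'X^2 = even_prod 'X K 0 :> {poly int}.
Proof.
rewrite /minus_prod rmorph_prod; apply: eq_bigr => i _.
by rewrite rmorphB rmorph1 /= comp_Xn_poly -exprM mul2n.
Qed.

Lemma minus_prod_double (R : comNzRingType) (x : R) K :
  minus_prod x K.*2 0 = odd_prod x K * even_prod x K 0.
Proof.
rewrite /minus_prod /odd_prod /even_prod; elim: K => [|K IH].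
  by rewrite !big_geq // mulr1.
rewrite doubleS !(big_nat_recr K.*2.+1, big_nat_recr K.*2, big_nat_recr K) //= IH.
ring.
Qed.

Lemma even_prod_stable K a :
  eqmX 0 K.*2 (even_prod 'X (K + a) 0) (even_prod 'X K 0).
Proof.
elim: a => [|a IH]; first by rewrite addn0; apply: eqmX_refl.
rewrite addnS /even_prod big_nat_recr //=; apply: eqmX_trans IH.
rewrite mulrBr mulr1 mulrC -mulrN; apply: eqmX_addXn; lia.
Qed.

Lemma euler_cube_mod2 K :
  eqmX 2 K.*2 (minus_prod 'X K.*2 0 ^+ 3) (triangles K.*2).
Proof.
set E := minus_prod _ _ _; set P := triangles _.
have EE : E = odd_prod 'X K * even_prod 'X K 0 by apply: minus_prod_double.
set O := odd_prod 'X K in EE; set V := even_prod 'X K 0 in EE.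
have O0 : O`_0 = 1.
  by rewrite /O /odd_prod coef0_prod big1 // => j _; rewrite coefB coef1 coefXn subr0.
have V0 : V`_0 = 1.
  by rewrite /V /even_prod coef0_prod big1 // => j _; rewrite coefB coef1 coefXn subr0.
(* With f_1 = O V and V = f_2 = f_1^2 mod 2 one gets O^2 V = 1 mod 2, so Gauss's
   V = O P yields P = f_1^3. *)
have VP : eqmX 2 K.*2 V (O * P) by apply/eqmX0/gauss_triangle.
have VE : eqmX 2 K.*2 (1 * V) (O ^+ 2 * V * V).
  rewrite mul1r; apply: (@eqmX_trans _ _ _ (E \Po 'X^2)).
    have := @even_prod_stable K K; rewrite addnn minus_prod_comp_X2 => st.
    exact/eqmX0/eqmX_sym.
  have -> : O ^+ 2 * V * V = E ^+ 2 by rewrite EE; ring.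
  by apply: eqmX_sym; apply: eqmX_frobenius.
have OV := eqmX_cancel V0 VE.
apply: (eqmX_cancel O0); apply: eqmX_sym; rewrite mulrC.
apply: eqmX_trans; first exact: eqmX_sym VP.
have -> : E ^+ 3 * O = (O ^+ 2 * V) ^+ 2 * V by rewrite EE; ring.
have := eqmXX 2 OV; rewrite expr1n => OV2.
by have := eqmX_mulr V OV2; rewrite mul1r.
Qed.

Lemma triangle_sqr i : (8 * (i * i.+1)./2 + 1 = i.*2.+1 ^ 2)%N.
Proof.
have : ~~ odd (i * i.+1) by rewrite oddM /=; case: odd.
by rewrite -!mulnn => h; have := odd_double_half (i * i.+1); rewrite (negbTE h); lia.
Qed.

(** Multiplying by 8 and adding 5 turns the equation into (2i+1)^2 + (4l+2)^2 = N, so the pair (i,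
    l) corresponds to j = 2l in [twosq_count]. *)
Lemma triangle_pairs_card n (N := (8 * n + 5)%N) :
  #|[set z : 'I_N.*2 * 'I_N.*2 | ((z.1 * z.1.+1)./2 + 4 * (z.2 * z.2.+1)./2 == n)%N]|
  = twosq_count N.
Proof.
have le1 : (N <= N.*2)%N by lia.
have lt2 (j : 'I_N) : (j./2 < N.*2)%N by have := ltn_ord j; lia.
pose f (z : 'I_N * 'I_N) := (widen_ord le1 z.1, Ordinal (lt2 z.2)).
(* An odd j would make the even square divisible by 16 and the sum 1 modulo 8. *)
have key (i j : nat) : (i.*2.+1 ^ 2 + j.+1.*2 ^ 2 = N)%N ->
  ~~ odd j /\ ((i * i.+1)./2 + 4 * (j./2 * j./2.+1)./2 = n)%N.
  move=> h; have ti := triangle_sqr i; have tj := triangle_sqr j./2.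
  have := odd_double_half j; case: (odd j) => hj.
    by move: h; rewrite -hj -ti /N -!mulnn => h; exfalso; nia.
  split=> //; move: h; rewrite -{1}hj -ti /N -!mulnn => h.
  by move: tj; rewrite -mulnn; nia.
rewrite /twosq_count -(card_in_imset (f := f)) => [|[i j] [i' j']].
  apply: eq_card => -[i l]; rewrite !inE /=; apply/eqP/imsetP => [h|[[i' j'] ]].
    have ti := triangle_sqr i; have tl := triangle_sqr l.
    have iN : (i < N)%N by move: ti; rewrite -mulnn /N; nia.
    have lN : (l.*2 < N)%N by move: tl; rewrite -mulnn /N; nia.
    exists (Ordinal iN, Ordinal lN).
      rewrite inE /= -ti; apply/eqP; move: tl; rewrite -!mulnn /N; nia.
    by congr pair; apply: val_inj; rewrite //= doubleK.
  by rewrite inE /= => /eqP/key[_ h] [-> ->].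
rewrite !inE /= => /eqP/key[oj _] /eqP/key[oj' _] [ii jj].
congr pair; apply: val_inj => //=.
lia.
Qed.

(** Modulo 2, f_2^6 = f_1^12 = (f_1^3)^4, so the product is P(q) P(q^4) with P the triangular
    series. *)
Lemma c_mod2 n : (2 %| c n - (twosq_count (8 * n + 5))%:Z)%Z.
Proof.
set N := (8 * n + 5)%N.
rewrite (@c_coef n N.*2) /N; last by lia.
set E := minus_prod _ _ _; set P := triangles N.*2.
have h : eqmX 2 N.*2 (E ^+ 3) P by apply: euler_cube_mod2.
have h4 : eqmX 2 N.*2 (E ^+ 3 * (E \Po 'X^2) ^+ 6) (P * (P \Po 'X^4)).
  apply: eqmXM => //; apply: (@eqmX_trans _ _ _ ((E ^+ 2) ^+ 6)).
    by apply: eqmXX; apply: eqmX_sym; apply: eqmX_frobenius.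
  have -> : (E ^+ 2) ^+ 6 = (E ^+ 3) ^+ 4 by rewrite -!exprM.
  apply: eqmX_trans; first exact: (eqmXX 4 h).
  have -> : P ^+ 4 = (P ^+ 2) ^+ 2 by rewrite -exprM.
  apply: eqmX_trans; first exact: (eqmXX 2 (@eqmX_frobenius _ P)).
  apply: eqmX_trans; first exact: eqmX_frobenius.
  by rewrite -comp_polyA comp_Xn_poly -exprM; apply: eqmX_refl.
have nN : (n < N.*2)%N by rewrite /N; lia.
have P4 : P \Po 'X^4 = \sum_(0 <= t < N.*2) 'X^(4 * (t * t.+1)./2).
  by rewrite rmorph_sum; apply: eq_bigr => j _ /=; rewrite comp_Xn_poly -exprM.
by have := h4 n nN; rewrite P4 coef_sumXn_mul triangle_pairs_card.
Qed.

(** * Sums of two squares *)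

Definition normsq (z : int * int) : int := z.1 ^+ 2 + z.2 ^+ 2.

(** The shift by N enumerates the box [-N, N]^2, which contains every Gaussian integer of norm N
    because |x| <= x^2. *)
Definition circle (N : nat) : {fset int * int} :=
  [fset z in [seq (i%:Z - N%:Z, j%:Z - N%:Z) | i <- iota 0 N.*2.+1, j <- iota 0 N.*2.+1]
     | normsq z == N%:Z].

Lemma in_circle N z : (z \in circle N) = (normsq z == N%:Z).
Proof.
rewrite /circle in_fset [LHS]inE; apply: andb_idl; case: z => x y.
rewrite {1}/normsq => /eqP h; rewrite /fst /snd in h.
apply/allpairsP; exists (`|(x + N%:Z)%R|%N, `|(y + N%:Z)%R|%N).
by rewrite !mem_iota /fst /snd; split; [nia | nia | congr pair; nia].
Qed.

Lemma card_involution (T : choiceType) (A : {fset T}) (P : pred T) (g : T -> T) :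
  (forall z, z \in A -> g z \in A) -> (forall z, g (g z) = z) ->
  (forall z, z \in A -> P (g z) = ~~ P z) ->
  #|` A| = (#|` [fset z in A | P z]|).*2.
Proof.
move=> gA gg gP; have inj : injective g by apply: can_inj gg.
rewrite -(cardfsID [fset z in A | P z] A) -addnn.
have -> : A `&` [fset z in A | P z] = [fset z in A | P z].
  by apply/fsetP => z; rewrite !inE /=; case: (z \in A).
congr addn; transitivity (#|` [fset g z | z in [fset z in A | P z]]|); last first.
  by rewrite card_imfset.
congr (#|` _|); apply/fsetP => z.
rewrite !inE /=; apply/andP/imfsetP => [[nPz zA]|[y]].
  exists (g z); last by rewrite gg.
  by rewrite !inE /= gA ?gP //; move: nPz; rewrite zA.
by rewrite !inE /= => /andP[yA Py] ->; rewrite gA // gP // Py.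
Qed.

Definition half_circle (N : nat) := [fset z in circle N | odd `|z.1|].
Definition quarter_circle (N : nat) := [fset z in half_circle N | 0 < z.1].

Lemma in_fset_sep (T : choiceType) (A : {fset T}) (P : pred T) z :
  (z \in [fset z in A | P z]) = (z \in A) && P z.
Proof. by rewrite !inE. Qed.

Lemma in_half_circle N z :
  (z \in half_circle N) = (normsq z == N%:Z) && odd `|z.1|.
Proof. by rewrite in_fset_sep in_circle. Qed.

Lemma in_quarter_circle N z : (z \in quarter_circle N) =
  [&& normsq z == N%:Z, odd `|z.1| & 0 < z.1].
Proof. by rewrite in_fset_sep in_half_circle -andbA. Qed.

(** For odd N exactly one coordinate is odd. Swapping coordinates halves the set, and so does
    changing the sign of the odd one, which is nonzero. *)
Lemma card_circle_quarter N : odd N ->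
  #|` circle N| = (4 * #|` quarter_circle N|)%N.
Proof.
move=> oN; rewrite (@card_involution _ _ (fun z => odd `|z.1|) (fun z => (z.2, z.1))).
- rewrite -/(half_circle N).
  rewrite (@card_involution _ _ (fun z => 0 < z.1) (fun z => (- z.1, z.2))).
  + by rewrite -/(quarter_circle N) -!muln2 -mulnA mulnC.
  + by move=> [x y]; rewrite !in_half_circle /normsq /= sqrrN abszN.
  + by move=> [x y] /=; rewrite opprK.
  + by move=> [x y]; rewrite in_half_circle /normsq /= => /andP[_]; lia.
- by move=> [x y]; rewrite !in_circle /normsq /= addrC.
- by case.
- move=> [x y]; rewrite !in_circle /normsq /= => /eqP h.
  have : odd `|(x ^+ 2 + y ^+ 2)%R|%N by rewrite h.
  by rewrite !expr2; nia.
Qed.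

(** A third halving, by the sign of the even coordinate: it is nonzero because N is not a square
    modulo 8. *)
Lemma card_quarter_twosq N : (N %% 8 = 5)%N ->
  #|` quarter_circle N| = (2 * twosq_count N)%N.
Proof.
move=> N5.
rewrite (@card_involution _ _ (fun z => 0 < z.2) (fun z => (z.1, - z.2))); first last.
- move=> [x y]; rewrite in_quarter_circle /normsq /= => /and3P[/eqP h ox x0].
  have : y != 0; last by lia.
  apply/eqP => y0; rewrite y0 expr0n addr0 in h.
  have := sqr_mod8 `|x|%N; have : (`|x| ^ 2 = N)%N by rewrite -abszX h.
  by move=> ->; rewrite N5; case: ifP => //; case: ifP.
- by move=> [x y] /=; rewrite opprK.
- by move=> [x y]; rewrite !in_quarter_circle /normsq /= sqrrN.
rewrite mul2n; congr double.
pose f (z : 'I_N * 'I_N) : int * int := (z.1.*2.+1%:Z, z.2.+1.*2%:Z).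
have injf : injective f.
  by move=> [i j] [i' j'] [] ? ?; congr pair; apply: val_inj => /=; lia.
rewrite /twosq_count; set B := [set z | _].
transitivity (#|` [fset f z | z in B]|); last first.
  by rewrite card_imfset //= -cardE.
congr (#|` _|); apply/fsetP => -[x y]; rewrite in_fset_sep in_quarter_circle /normsq /=.
apply/idP/imfsetP => /= [/andP[/and3P[/eqP h ox x0] y0]|[[i j]]].
  have hN : (`|x|%N ^ 2 + `|y|%N ^ 2 = N)%N by lia.
  have oy : ~~ odd `|y|.
    have : odd (`|x|%N ^ 2 + `|y|%N ^ 2) by rewrite hN; lia.
    by rewrite oddD !oddX ox.
  have iN : (`|x|./2 < N)%N by rewrite -!mulnn in hN; nia.
  have jN : (`|y|./2.-1 < N)%N by rewrite -!mulnn in hN; nia.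
  have xE : (`|x|./2).*2.+1 = `|x|%N by lia.
  have yE : (`|y|./2.-1).+1.*2 = `|y|%N by lia.
  exists (Ordinal iN, Ordinal jN); first by rewrite inE /= xE yE hN.
  by congr pair => /=; rewrite ?xE ?yE; lia.
rewrite inE /= => /eqP h [-> ->]; apply/andP; split=> //; apply/and3P; split=> //.
  by move: h; rewrite -!mulnn; lia.
by rewrite /= odd_double.
Qed.

(** * Primes that are sums of two squares *)

Lemma prime_dvdzM (p : nat) (x y : int) : prime p ->
  (p%:Z %| x * y)%Z = (p%:Z %| x)%Z || (p%:Z %| y)%Z.
Proof. by move=> pp; rewrite !dvdzE abszM Euclid_dvdM. Qed.

Lemma prime_dvdzX2 (p : nat) (x : int) : prime p ->
  (p%:Z %| x ^+ 2)%Z = (p%:Z %| x)%Z.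
Proof. by move=> pp; rewrite expr2 prime_dvdzM // orbb. Qed.

Lemma nat_sqrt n : exists r, (r ^ 2 <= n < r.+1 ^ 2)%N.
Proof.
elim: n => [|n [r /andP[rn nr]]]; first by exists 0%N.
case: (ltnP n.+1 (r.+1 ^ 2)) => h; first by exists r; rewrite h (leq_trans rn).
by exists r.+1; rewrite h; move: nr; rewrite -!mulnn; lia.
Qed.

Lemma prime_neq_sqr (r p : nat) : prime p -> (r ^ 2 != p)%N.
Proof.
move=> pp; apply/eqP => r2; move: pp; rewrite -r2 -mulnn => /primeP[p1 /(_ r)].
by rewrite dvdn_mulr // => /(_ isT) /orP[] /eqP; nia.
Qed.

(** Thue's pigeonhole argument: with r the integer square root of p, the (r+1)^2 > p pairs (u, v)
    yield a collision of uy - vx modulo p. The differences a, b satisfy 0 < a^2 + b^2 < 2p and p |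
    a^2 + b^2. *)
Lemma thue (p : nat) (x y : int) : prime p ->
  (p%:Z %| x ^+ 2 + y ^+ 2)%Z -> ~~ (p%:Z %| y)%Z ->
  exists a b : int, p%:Z = a ^+ 2 + b ^+ 2.
Proof.
move=> pp pxy py; have p_gt0 := prime_gt0 pp.
have [r /andP[rp pr]] := nat_sqrt p.
have modp (k : int) : (`|(k %% p%:Z)%Z| < p)%N.
  have := ltz_pmod k (d := p%:Z); have := modz_ge0 k (d := p%:Z); lia.
pose g (z : 'I_r.+1 * 'I_r.+1) : int := z.1%:Z * y - z.2%:Z * x.
pose f z : 'I_p := Ordinal (modp (g z)).
have /injectivePn[[u v] [[u' v'] neq [fE]]] : ~~ injectiveb f.
  apply/negP => /injectiveP/leq_card; rewrite card_prod !card_ord; lia.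
have gE : (p%:Z %| g (u, v) - g (u', v'))%Z.
  rewrite -eqz_mod_dvd; apply/eqP.
  have := modz_ge0 (g (u, v)) (d := p%:Z).
  by have := modz_ge0 (g (u', v')) (d := p%:Z); lia.
pose a := u%:Z - u'%:Z; pose b := v%:Z - v'%:Z; exists a, b.
have pab : (p%:Z %| a ^+ 2 + b ^+ 2)%Z.
  have : (p%:Z %| (a ^+ 2 + b ^+ 2) * y ^+ 2)%Z.
    have -> : (a ^+ 2 + b ^+ 2) * y ^+ 2 =
      (g (u, v) - g (u', v')) * (a * y + b * x) + b ^+ 2 * (x ^+ 2 + y ^+ 2).
      by rewrite /g /a /b /=; ring.
    by apply: rpredD; [apply: dvdz_mulr | apply: dvdz_mull].
  by rewrite prime_dvdzM // prime_dvdzX2 // (negbTE py) orbF.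
have ab0 : 0 < a ^+ 2 + b ^+ 2.
  rewrite lt_def addr_ge0 ?sqr_ge0 // andbT paddr_eq0 ?sqr_ge0 // !sqrf_eq0.
  apply: contraNN neq; rewrite !subr_eq0 !eqz_nat => /andP[/eqP uu /eqP vv].
  by apply/eqP; congr pair; apply: val_inj.
(* A prime is not a square, so r^2 < p strictly, as the bound 2p requires. *)
have rp' := prime_neq_sqr r pp.
have sq (n k : 'I_r.+1) : (n%:Z - k%:Z) ^+ 2 <= r%:Z ^+ 2.
  by have := ltn_ord n; have := ltn_ord k; clear; nia.
have r2p : r%:Z ^+ 2 < p%:Z by move: rp rp'; clear; rewrite -mulnn; lia.
have ab2 : a ^+ 2 + b ^+ 2 < 2 * p%:Z.
  by have := sq u u'; have := sq v v'; rewrite -/a -/b; move: r2p; clear; lia.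
case/dvdzP: pab ab0 ab2 => q ->; move: p_gt0; clear => p_gt0.
rewrite pmulr_lgt0 // ltr_pM2r // => q0 q2.
have q1 : q = 1 by lia.
by rewrite q1 mul1r.
Qed.

(** Stands in for the classification of primes modulo 4: if p divides x^2 + y^2 but not y, then
    [thue] represents p. *)
Lemma two_square_prime_or_inert (p : nat) : prime p ->
  (exists a b : int, p%:Z = a ^+ 2 + b ^+ 2) \/
  (forall x y : int, (p%:Z %| x ^+ 2 + y ^+ 2)%Z -> (p%:Z %| x)%Z && (p%:Z %| y)%Z).
Proof.
move=> pp; case: (boolP [exists a : 'I_p, exists b : 'I_p, a ^ 2 + b ^ 2 == p]%N).
  by case/existsP => a /existsP[b /eqP h]; left; exists a%:Z, b%:Z; rewrite -{1}h; lia.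
move=> none; right=> x y pxy; case: (boolP (p%:Z %| y)%Z) => py.
  by move: pxy; rewrite rpredDr ?prime_dvdzX2 // => ->.
case: (thue pp pxy py) => a [b h]; case/existsP: none.
have p2 : p%:Z < p%:Z ^+ 2 by have := prime_gt1 pp; clear; nia.
have ap : (`|a|%N < p)%N by move: h p2; clear; nia.
have bp : (`|b|%N < p)%N by move: h p2; clear; nia.
exists (Ordinal ap); apply/existsP; exists (Ordinal bp); apply/eqP => /=.
by move: h; clear; lia.
Qed.

(** * Multiplication of Gaussian integers and the recursion for points of norm pN *)

Definition mulz (z w : int * int) : int * int :=
  (z.1 * w.1 - z.2 * w.2, z.2 * w.1 + z.1 * w.2).

Definition conjz (z : int * int) : int * int := (z.1, - z.2).

Definition scalez (k : int) (z : int * int) : int * int := (k * z.1, k * z.2).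

Definition dvd2 (p : nat) (z : int * int) : bool := (p%:Z %| z.1)%Z && (p%:Z %| z.2)%Z.

Definition divisible_points (p N : nat) := [fset z in circle N | dvd2 p z].

Lemma normsqM z w : normsq (mulz z w) = normsq z * normsq w.
Proof. by rewrite /normsq /=; ring. Qed.

Lemma normsq_conj z : normsq (conjz z) = normsq z.
Proof. by rewrite /normsq /= sqrrN. Qed.

Lemma mulz_conj z w : mulz z (mulz (conjz z) w) = scalez (normsq z) w.
Proof. by rewrite /mulz /scalez /normsq /=; congr pair; ring. Qed.

Lemma mul_conjz z w : mulz (conjz z) (mulz z w) = scalez (normsq z) w.
Proof. by rewrite /mulz /scalez /normsq /=; congr pair; ring. Qed.

Lemma scalez_inj k : k != 0 -> injective (scalez k).
Proof.
move=> k0 [x y] [x' y'] []; do 2!move/(mulfI k0) => /= ?; exact: congr2.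
Qed.

Lemma mulz_inj z : normsq z != 0 -> injective (mulz z).
Proof.
by move=> z0 w w' /(congr1 (mulz (conjz z))); rewrite !mul_conjz => /(scalez_inj z0).
Qed.

Lemma normsq_scale k z : normsq (scalez k z) = k ^+ 2 * normsq z.
Proof. by rewrite /normsq /=; ring. Qed.

Lemma dvd2_scale p z : dvd2 p z -> exists w, z = scalez p%:Z w.
Proof.
case: z => x y /andP[/= /dvdzP[a ->] /dvdzP[b ->]].
by exists (a, b); rewrite /scalez /= ![_ * p%:Z]mulrC.
Qed.

Lemma card_divisible (p N : nat) : prime p ->
  #|` divisible_points p (p * (p * N))| = #|` circle N|.
Proof.
move=> pp; have p0 : p%:Z != 0 by have := prime_gt0 pp; lia.
transitivity (#|` [fset scalez p%:Z z | z in circle N]|); last first.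
  by rewrite card_imfset //; apply: scalez_inj.
congr (#|` _|); apply/fsetP => z; rewrite in_fset_sep in_circle.
apply/andP/imfsetP => [[/eqP zN /dvd2_scale[w zE]]|[w]].
  exists w => //; rewrite /= in_circle; move: zN; rewrite zE normsq_scale => wN.
  apply/eqP; apply: (mulfI p0); apply: (mulfI p0).
  by move: wN; rewrite !PoszM expr2 -mulrA.
rewrite /= in_circle => /eqP wN ->; rewrite normsq_scale wN !PoszM expr2 -mulrA eqxx.
by rewrite /dvd2 /= !dvdz_mulr.
Qed.

Lemma divisible_points0 (p M : nat) : prime p -> ~~ (p %| M)%N ->
  divisible_points p (p * M) = fset0.
Proof.
move=> pp pM; apply/fsetP => z; rewrite in_fset_sep in_circle in_fset0.
apply/negbTE/negP => /andP[/eqP zN /dvd2_scale[w zE]]; move: zN.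
have p0 : p%:Z != 0 by have := prime_gt0 pp; lia.
rewrite zE normsq_scale expr2 -mulrA PoszM => /(mulfI p0) h.
by move: pM; rewrite -[(p %| M)%N]/(p%:Z %| M%:Z)%Z -h dvdz_mulr.
Qed.

Lemma circle_inert (p N : nat) : prime p ->
  (forall x y : int, (p%:Z %| x ^+ 2 + y ^+ 2)%Z -> (p%:Z %| x)%Z && (p%:Z %| y)%Z) ->
  circle (p * N) = divisible_points p (p * N).
Proof.
move=> pp h; apply/fsetP => z; rewrite in_fset_sep in_circle andb_idr //.
by move=> /eqP zN; apply: h; rewrite -/(normsq z) zN PoszM dvdz_mulr.
Qed.

(** The multiples of z0 and those of its conjugate cover the points of norm pN, and they meet
    exactly in the points divisible by p; inclusion-exclusion concludes. *)
Lemma card_circle_split (p N : nat) (z0 : int * int) : prime p -> odd p ->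
  normsq z0 = p%:Z ->
  (#|` circle (p * N)| + #|` divisible_points p (p * N)| = 2 * #|` circle N|)%N.
Proof.
move=> pp op zp; have p0 : p%:Z != 0 by have := prime_gt0 pp; lia.
have zn0 : normsq z0 != 0 by rewrite zp.
have zn0' : normsq (conjz z0) != 0 by rewrite normsq_conj zp.
pose A := [fset mulz z0 w | w in circle N].
pose B := [fset mulz (conjz z0) w | w in circle N].
have cA : #|` A| = #|` circle N| by rewrite card_imfset //; apply: mulz_inj.
have cB : #|` B| = #|` circle N| by rewrite card_imfset //; apply: mulz_inj.
(* If p divides one coordinate of z2 z, it divides the other because it divides the norm. Then z2 z
   = p w, and z = z1 w. *)
have inMul z1 z2 z : normsq z1 = p%:Z -> normsq z2 = p%:Z ->
    (forall w, mulz z1 (mulz z2 w) = scalez p%:Z w) ->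
    normsq z = (p * N)%N%:Z ->
    (p%:Z %| (mulz z2 z).1)%Z || (p%:Z %| (mulz z2 z).2)%Z ->
  z \in [fset mulz z1 w | w in circle N].
  move=> n1 n2 h zN pv.
  have vN : normsq (mulz z2 z) = p%:Z * (p%:Z * N%:Z).
    by rewrite normsqM n2 zN PoszM.
  have /dvd2_scale[w vw] : dvd2 p (mulz z2 z).
    have pn : (p%:Z %| (mulz z2 z).1 ^+ 2 + (mulz z2 z).2 ^+ 2)%Z.
      by rewrite -/(normsq _) vN dvdz_mulr.
    rewrite /dvd2; case/orP: pv => pv; rewrite pv /= ?andbT.
      by move: pn; rewrite rpredDl prime_dvdzX2.
    by move: pn; rewrite rpredDr prime_dvdzX2.
  apply/imfsetP; exists w; rewrite /= ?in_circle.
    apply/eqP; apply: (mulfI p0); apply: (mulfI p0); rewrite -vN vw normsq_scale.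
    by rewrite expr2 mulrA.
  apply: (scalez_inj p0); rewrite -h vw.
  by rewrite /mulz /scalez /=; congr pair; ring.
have conjK : conjz (conjz z0) = z0 by rewrite /conjz opprK; case: (z0).
have np : normsq (conjz z0) = p%:Z by rewrite normsq_conj.
have inA := inMul _ _ _ zp np.
have inB := inMul _ _ _ np zp.
have hA w : mulz z0 (mulz (conjz z0) w) = scalez p%:Z w by rewrite mulz_conj zp.
have hB w : mulz (conjz z0) (mulz z0 w) = scalez p%:Z w by rewrite mul_conjz zp.
have subN z1 z : normsq z1 = p%:Z -> z \in [fset mulz z1 w | w in circle N] ->
    normsq z = (p * N)%N%:Z.
  by move=> n1 /imfsetP[w /= + ->]; rewrite in_circle normsqM n1 => /eqP ->.
have eU : circle (p * N) = A `|` B.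
  apply/fsetP => z; rewrite in_circle in_fsetU; apply/eqP/orP => [zN|[]]; last first.
  - exact: subN np.
  - exact: subN zp.
  (* The product of the two second coordinates is a combination of the norms of z and z0, so p
     divides one of them. *)
  have : (p%:Z %| (mulz (conjz z0) z).2 * (mulz z0 z).2)%Z.
    have -> : (mulz (conjz z0) z).2 * (mulz z0 z).2
      = z0.1 ^+ 2 * normsq z - z.1 ^+ 2 * normsq z0.
      by rewrite /mulz /normsq /=; ring.
    by rewrite zN zp PoszM rpredB // dvdz_mull // dvdz_mulr.
  rewrite prime_dvdzM // => /orP[h|h]; [left; apply: inA | right; apply: inB] => //.
    by rewrite h orbT.
  by rewrite h orbT.
have pa : ~~ (p%:Z %| z0.1)%Z.
  apply/negP => pa; have pb : (p%:Z %| z0.2)%Z.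
    have : (p%:Z %| z0.1 ^+ 2 + z0.2 ^+ 2)%Z by rewrite -/(normsq _) zp.
    by rewrite rpredDl prime_dvdzX2.
  have /dvd2_scale[w zw] : dvd2 p z0 by rewrite /dvd2 pa pb.
  move: zp; rewrite zw normsq_scale => /eqP; rewrite expr2 -mulrA -[X in _ == X]mulr1.
  rewrite (inj_eq (mulfI p0)) => /eqP h.
  have : (p%:Z %| 1%R)%Z by rewrite -h dvdz_mulr.
  by rewrite dvdz1 => /eqP p1; have := prime_gt1 pp; move: p1; clear; lia.
have p2 : ~~ (p%:Z %| 2)%Z.
  apply/negP; rewrite dvdzE /= (dvdn_prime2 pp) // => /eqP p2; by rewrite p2 in op.
have eI : divisible_points p (p * N) = A `&` B.
  apply/fsetP => z; rewrite in_fset_sep in_circle in_fsetI.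
  apply/andP/andP => [[/eqP zN /dvd2_scale[v zv]]|[zA zB]].
    split; [apply: inA | apply: inB] => //; apply/orP; left;
      by rewrite zv /= rpredB // dvdz_mull // dvdz_mulr.
  split; first by rewrite (subN _ _ zp zA).
  have [pA1 pA2] :
      (p%:Z %| (mulz (conjz z0) z).1)%Z /\ (p%:Z %| (mulz (conjz z0) z).2)%Z.
    by case/imfsetP: zA => w _ ->; rewrite hB /= !dvdz_mulr.
  have [pB1 pB2] : (p%:Z %| (mulz z0 z).1)%Z /\ (p%:Z %| (mulz z0 z).2)%Z.
    by case/imfsetP: zB => w _ ->; rewrite hA /= !dvdz_mulr.
  (* The sum of conj(z0) z and z0 z is 2 Re(z0) z, and p is prime to 2 Re(z0). *)
  have := rpredD pA1 pB1; have := rpredD pA2 pB2.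
  have -> : (mulz (conjz z0) z).1 + (mulz z0 z).1 = 2 * (z0.1 * z.1).
    by rewrite /mulz /=; ring.
  have -> : (mulz (conjz z0) z).2 + (mulz z0 z).2 = 2 * (z0.1 * z.2).
    by rewrite /mulz /=; ring.
  have k (x : int) : (p%:Z %| 2 * (z0.1 * x))%Z -> (p%:Z %| x)%Z.
    by rewrite !prime_dvdzM // (negbTE pa) (negbTE p2).
  by move=> /k h2 /k h1; rewrite /dvd2 h1 h2.
by rewrite eU eI cardfsUI cA cB; lia.
Qed.

(** Removing p^2 repeatedly leads to norm pM, where a point divisible by p would force p^2 | pM. *)
Lemma card_circle_inert_odd (p M e : nat) : prime p ->
  (forall x y : int, (p%:Z %| x ^+ 2 + y ^+ 2)%Z -> (p%:Z %| x)%Z && (p%:Z %| y)%Z) ->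
  ~~ (p %| M)%N -> #|` circle (p ^ e.*2.+1 * M)| = 0%N.
Proof.
move=> pp h pM; elim: e => [|e IH].
  by rewrite expn1 circle_inert // divisible_points0.
rewrite doubleS expnS -mulnA circle_inert //.
by rewrite [(p ^ _.+2)%N]expnS -mulnA card_divisible.
Qed.

(** The recursion says that the counts form an arithmetic progression in e, so the induction carries
    two consecutive terms. *)
Lemma card_circle_split_pow (p M e : nat) (z0 : int * int) : prime p -> odd p ->
  normsq z0 = p%:Z -> ~~ (p %| M)%N ->
  #|` circle (p ^ e * M)| = (e.+1 * #|` circle M|)%N.
Proof.
move=> pp op zp pM.
suff [] : #|` circle (p ^ e * M)| = (e.+1 * #|` circle M|)%N /\
          #|` circle (p ^ e.+1 * M)| = (e.+2 * #|` circle M|)%N by [].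
elim: e => [|e [IH1 IH2]].
  rewrite expn0 !mul1n expn1; split=> //.
  by have := card_circle_split M pp op zp; rewrite divisible_points0 // cardfs0 addn0.
split=> //; have := card_circle_split (p ^ e.+1 * M) pp op zp.
rewrite {2}[(p ^ e.+1)%N]expnS -[in X in divisible_points _ X]mulnA card_divisible //.
rewrite IH1 IH2.
by rewrite mulnA -expnS; lia.
Qed.

(** * Parity of C(N) and of [kappa] *)

Lemma card_circle_twosq N : (N %% 8 = 5)%N -> #|` circle N| = (8 * twosq_count N)%N.
Proof.
by move=> N5; rewrite card_circle_quarter ?card_quarter_twosq ?mulnA //; lia.
Qed.

(** If p is a norm, 8 C(N) is 4k + 4 times a multiple of 4, hence divisible by 16; otherwise C(N) =
    0. *)
Lemma twosq_count_even (p M k : nat) : prime p -> odd p -> ~~ (p %| M)%N ->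
  ((p ^ (4 * k + 3) * M) %% 8 = 5)%N -> ~~ odd (twosq_count (p ^ (4 * k + 3) * M)).
Proof.
move=> pp op pM N5; have := card_circle_twosq N5.
have oM : odd M.
  have : odd (p ^ (4 * k + 3) * M) by lia.
  by rewrite oddM => /andP[].
case: (two_square_prime_or_inert pp) => [[a [b ab]]|inert].
  rewrite (card_circle_split_pow _ (z0 := (a, b))) // card_circle_quarter //.
  by lia.
have e3 : (4 * k + 3 = (2 * k).+1.*2.+1)%N by lia.
by rewrite {1}e3 card_circle_inert_odd //; lia.
Qed.

Lemma twosq_count5 : twosq_count 5 = 1%N.
Proof.
transitivity #|[set (ord0 : 'I_5, ord0 : 'I_5)]|; last by rewrite cards1.
apply: eq_card => -[i j]; rewrite !inE xpair_eqE -!val_eqE /=.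
by rewrite -!mulnn; apply/eqP/andP => [h|[/eqP -> /eqP ->]] //; split; nia.
Qed.

(** Starting from the 8 points of norm 5, C(5p^2) is 3 if p is a norm and 1 otherwise. *)
Lemma twosq_count_5p2 (p : nat) : prime p -> odd p -> p != 5%N ->
  odd (twosq_count (5 * p ^ 2)).
Proof.
move=> pp op p5; have p2 := sqr_mod8 p; rewrite op in p2.
have N5 : ((5 * p ^ 2) %% 8 = 5)%N by lia.
have := card_circle_twosq N5.
have c5 : #|` circle 5| = 8%N by rewrite card_circle_twosq // twosq_count5.
have p5' : ~~ (p %| 5)%N by rewrite dvdn_prime2.
rewrite [in X in circle X]mulnC.
case: (two_square_prime_or_inert pp) => [[a [b ab]]|inert].
  rewrite (card_circle_split_pow _ (z0 := (a, b))) // c5.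
  by lia.
rewrite -mulnn -[in X in circle X]mulnA circle_inert // card_divisible // c5.
by lia.
Qed.

Lemma kappa_even (p : nat) : prime p -> odd p -> (2 %| kappa p)%Z.
Proof.
move=> pp op; have p2 := sqr_mod8 p; rewrite op in p2.
have p1 := prime_gt1 pp.
have nE : (8 * ((5 * (p ^ 2 - 1)) %/ 8) + 5 = 5 * p ^ 2)%N.
  by have : (p ^ 2 > 0)%N; [rewrite expn_gt0 prime_gt0 | lia].
have := c_mod2 ((5 * (p ^ 2 - 1)) %/ 8); rewrite nE /kappa.
set n := (_ %/ 8)%N; set x := legendre _ _.
(* At p = 5 the symbol is 0 and C(125) is even. Otherwise the symbol is 1 or -1, and the odd p^3
   cancels the parity of the odd C(5p^2). *)
have [p5|p5] := eqVneq p 5%N.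
  have -> : x = 0 by rewrite /x p5.
  have e : (5 * p ^ 2 = 5 ^ (4 * 0 + 3) * 1)%N by rewrite p5.
  have : ~~ odd (twosq_count (5 * p ^ 2)).
    by rewrite e; apply: twosq_count_even.
  by rewrite mulr0 addr0; lia.
have p3 : odd (p ^ 3) by rewrite oddX op orbT.
have pE : p%:Z ^+ 3 = (p ^ 3)%N%:Z by rewrite -!natz natrX.
have := twosq_count_5p2 pp op p5.
have [-> | ->] : x = 1 \/ x = -1.
- rewrite /x /legendre.
  have -> : (p%:Z %| - ((5 * (p ^ 2 - 1)) %/ 4)%N%:Z)%Z = false.
    apply/negbTE; rewrite dvdzE abszN /=; apply/negP => h.
    have : (p %| 5 * (p ^ 2 - 1))%N.
      have -> : (5 * (p ^ 2 - 1) = (5 * (p ^ 2 - 1)) %/ 4 * 4)%N by lia.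
      exact: dvdn_mulr.
    rewrite Euclid_dvdM // dvdn_prime2 // (negbTE p5) /= => h2.
    have : (p %| p ^ 2 - (p ^ 2 - 1))%N by rewrite dvdn_sub // dvdn_exp.
    by rewrite subKn ?expn_gt0 ?prime_gt0 // dvdn1; lia.
  by case: ifP => _; [left | right].
- by rewrite pE mulr1; lia.
- by rewrite pE mulrN1; lia.
Qed.

Theorem theorem1p10 (m alpha beta p : nat)
    (hm : (1 <= m)%N) (halpha : (1 <= alpha)%N) (hbeta : (1 <= beta)%N)
    (alpha_odd : ~~ (2 %| alpha)%N) (p_prime : prime p) (p_ge3 : (3 <= p)%N) :
  (forall n k : nat, ~~ (p %| n)%N ->
     (abar (2 ^ m * alpha)
        (8 * p ^ (nu p * (k + 1) - 1) * n + 5 * p ^ (nu p * (k + 1)))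
        = 0 %[mod 2 ^ (m + 3)])%N
     /\ (abar (2 * beta + 1)
           (8 * p ^ (nu p * (k + 1) - 1) * n + 5 * p ^ (nu p * (k + 1)))
           = 0 %[mod 16])%N)
  /\ ((kappa p = 1 %[mod 2])%Z ->
      forall n k : nat, ~~ (p %| 8 * n + 5)%N ->
        (abar (2 ^ m * alpha)
           (8 * p ^ (6 * k + 2) * n + 5 * p ^ (6 * k + 2))
           = 0 %[mod 2 ^ (m + 3)])%N
        /\ (abar (2 * beta + 1)
              (8 * p ^ (6 * k + 2) * n + 5 * p ^ (6 * k + 2))
              = 0 %[mod 16])%N).
Proof.
have op : odd p by case: (even_prime p_prime) => // p2; rewrite p2 in p_ge3.
have kap := kappa_even p_prime op.
split; last by move=> h; move: kap; lia.
move=> n k pn; rewrite /nu kap.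
have -> : (4 * (k + 1) - 1 = 4 * k + 3)%N by lia.
have -> : (4 * (k + 1) = (4 * k + 3) + 1)%N by lia.
set N := (_ + _)%N.
have NE : N = (p ^ (4 * k + 3) * (8 * n + 5 * p))%N.
  by rewrite /N addn1 expnSr; lia.
have N5 : (N %% 8 = 5)%N.
  (* An even power of an odd number is 1 modulo 8, so the second summand of N is 5 modulo 8. *)
  have p4 : (p ^ (4 * k + 3 + 1) %% 8 = 1)%N.
    have -> : (4 * k + 3 + 1 = 2 * (2 * k + 2))%N by lia.
    by rewrite expnM -modnXm sqr_mod8 op exp1n.
  by rewrite /N; lia.
have pM : ~~ (p %| 8 * n + 5 * p)%N.
  rewrite (dvdn_addl _ (dvdn_mull 5 (dvdnn p))) Euclid_dvdM // (negbTE pn) orbF.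
  rewrite (Euclid_dvdX 2 3) // dvdn_prime2 // andbT; apply/eqP; lia.
have Ceven : ~~ odd (twosq_count N).
  by rewrite NE in N5 *; apply: twosq_count_even.
split; apply/eqP; rewrite mod0n -/(dvdn _ _).
  (* Writing m as m + 1 matches the shifted exponent of [abar_even_dvd]. *)
  case: m hm => // m _; rewrite addn3.
  exact: abar_even_dvd.
have -> : (2 * beta + 1 = beta.*2.+1)%N by lia.
exact: abar_odd_dvd.
Qed.
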